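(* Let $\mathtt C$ be a pointed category with zero object $0$, viewed as an $\mathbb A\mathbb V$-coalgebra $(\mathtt C,\beta^{\mathtt C},\beta_{\mathtt C})$ with $\beta^{\mathtt C}(a)=(!^a:0\to a)$ and $\beta_{\mathtt C}(a)=(!_a:a\to 0)$. Then $\mathtt C$ has (chosen, normalized) cokernels and kernels if and only if it is equipped with a (normalized) colax $\mathbb T_1$-algebra structure $(\mathtt C,\alpha_1,\phi_1)$ and a (normalized) lax $\mathbb T_2$-algebra structure $(\mathtt C,\alpha_2,\phi_2)$. If so, these structures satisfy a unique mixed lax rewriting rule $\psi$; its components are the morphisms $$\psi_S:\operatorname{coker}(\alpha_2(S))\longrightarrow\ker(\alpha_1(\lambda(S)))$$ induced by the universal properties of cokernels and kernels, for each commutative square $S=(h_0,h_1):f\to g$ in $\mathtt C$ (with $f:a\to b$, $g:c\to d$, $h_0:a\to c$, $h_1:b\to d$, $gh_0=h_1f$); that is, $\psi_S$ is the unique morphism with $$\kappa_{\alpha_1(\lambda(S))}\circ\psi_S\circ\pi_{\alpha_2(S)}=\pi_{h_0}\circ\kappa_g .$$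
   Context: All 2-categories, 2-monads and 2-comonads are strict. The dot $\cdot$ denotes composition and whiskering; $\Box$ is vertical composition of 2-cells, right to left. Arrow comonads. For a category $\mathtt C$, $\mathbb A\mathtt C=\mathbb V\mathtt C$ is the category of morphisms of $\mathtt C$; a morphism $S=(h_0,h_1):f\to g$ from $f:a\to b$ to $g:c\to d$ is a commutative square $gh_0=h_1f$. Both act on functors and natural transformations by post-composition. $\mathbb A$ is a 2-comonad on $\mathtt{Cat}$ with $\epsilon_{\mathtt C}(f:a\to b)=a$, $\delta_{\mathtt C}(f)=((f,\mathrm{id}_b):f\to\mathrm{id}_b)$; $\mathbb V$ is a 2-comonad with $\epsilon^{\mathtt C}(f:a\to b)=b$, $\delta^{\mathtt C}(f)=((\mathrm{id}_a,f):\mathrm{id}_a\to f)$. The isomorphism $\lambda:\mathbb V\mathbb A\mathtt C\to\mathbb A\mathbb V\mathtt C$ transposes squares: $\lambda(S)=((f,g):h_0\to h_1)$. The 2-category of $\mathbb A\mathbb V$-coalgebras: objects $(\mathtt C,\beta^{\mathtt C},\beta_{\mathtt C})$ with $\beta^{\mathtt C}:\mathtt C\to\mathbb V\mathtt C$ a (strict) $\mathbb V$-coalgebra, $\beta_{\mathtt C}:\mathtt C\to\mathbb A\mathtt C$ a (strict) $\mathbb A$-coalgebra and $\lambda\cdot\mathbb V\beta_{\mathtt C}\cdot\beta^{\mathtt C}=\mathbb A\beta^{\mathtt C}\cdot\beta_{\mathtt C}$; 1-cells are functors strictly commuting with both structures; 2-cells are natural transformations compatible with both structures. On it there are 2-monads,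 acting on 1- and 2-cells as $\mathbb V$, resp. $\mathbb A$: $\mathbb T_1(\mathtt C,\beta^{\mathtt C},\beta_{\mathtt C})=(\mathbb V\mathtt C,\delta^{\mathtt C},\lambda\cdot\mathbb V\beta_{\mathtt C})$, $\mu_1=\mathbb V\epsilon^{\mathtt C}$, $\eta_1=\beta^{\mathtt C}$; and $\mathbb T_2(\mathtt C,\beta^{\mathtt C},\beta_{\mathtt C})=(\mathbb A\mathtt C,\lambda^{-1}\cdot\mathbb A\beta^{\mathtt C},\delta_{\mathtt C})$, $\mu_2=\mathbb A\epsilon_{\mathtt C}$, $\eta_2=\beta_{\mathtt C}$. The map $\lambda$ is an invertible distributive law $\mathbb T_1\mathbb T_2\Rightarrow\mathbb T_2\mathbb T_1$. Normalized lax $\mathbb T$-algebra: $\alpha:\mathbb TA\to A$, $\phi:\alpha\cdot\mathbb T\alpha\Rightarrow\alpha\cdot\mu_A$ with $\alpha\cdot\eta_A=\mathrm{id}$, $\phi\cdot\mathbb T\eta_A=\mathrm{id}_\alpha=\phi\cdot\eta_{\mathbb TA}$ and $(\phi\cdot\mu_{\mathbb TA})\Box(\phi\cdot\mathbb T^2\alpha)=(\phi\cdot\mathbb T\mu_A)\Box(\alpha\cdot\mathbb T\phi)$. Normalized colax $\mathbb T$-algebra: the same with $\phi:\alpha\cdot\mu_A\Rightarrow\alpha\cdot\mathbb T\alpha$ and $(\phi\cdot\mathbb T^2\alpha)\Box(\phi\cdot\mu_{\mathbb TA})=(\alpha\cdot\mathbb T\phi)\Box(\phi\cdot\mathbb T\mu_A)$.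 Mixed lax rewriting rule between a colax $\mathbb T_1$-algebra $(A,\alpha_1,\phi_1)$ and a lax $\mathbb T_2$-algebra $(A,\alpha_2,\phi_2)$: a 2-cell $\psi:\alpha_1\cdot\mathbb T_1\alpha_2\Rightarrow\alpha_2\cdot\mathbb T_2\alpha_1\cdot\lambda_A$ with (a) $(\phi_2\cdot\mathbb T_2^2\alpha_1\cdot\mathbb T_2\lambda_A\cdot\lambda_{\mathbb T_2A})\Box(\alpha_2\cdot\mathbb T_2\psi\cdot\lambda_{\mathbb T_2A})\Box(\psi\cdot\mathbb T_1\mathbb T_2\alpha_2)=(\psi\cdot\mathbb T_1\mu_2(A))\Box(\alpha_1\cdot\mathbb T_1\phi_2)$; (b) $(\psi\cdot\mathbb T_1\mathbb T_2\alpha_1\cdot\mathbb T_1\lambda_A)\Box(\alpha_1\cdot\mathbb T_1\psi)\Box(\phi_1\cdot\mathbb T_1^2\alpha_2)=(\alpha_2\cdot\mathbb T_2\phi_1\cdot\lambda_{\mathbb T_1A}\cdot\mathbb T_1\lambda_A)\Box(\psi\cdot\mu_1(\mathbb T_2A))$; (c) $\psi\cdot\eta_1(\mathbb T_2A)=\mathrm{id}_{\alpha_2}$; (d) $\psi\cdot\mathbb T_1\eta_2(A)=\mathrm{id}_{\alpha_1}$. Chosen, normalized kernels and cokernels: a choice, for every morphism $f:a\to b$, of a kernel $\kappa_f:\ker f\to a$ and a cokernel $\pi_f:b\to\operatorname{coker}f$ with $\kappa_{!_a}=\mathrm{id}_a$, $\kappa_{\mathrm{id}_a}=\,!^a$,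 $\pi_{!^a}=\mathrm{id}_a$, $\pi_{\mathrm{id}_a}=\,!_a$. The correspondence with algebra structures is: $\alpha_2(f)=\ker f$, $\alpha_1(f)=\operatorname{coker}f$, $\kappa_f=\alpha_2\big((\mathrm{id}_a,!_b):f\to\,!_a\big):\alpha_2(f)\to\alpha_2(!_a)=a$ and $\pi_f=\alpha_1\big((!^a,\mathrm{id}_b):\,!^b\to f\big):b=\alpha_1(!^b)\to\alpha_1(f)$; on squares, $\alpha_2(S):\ker f\to\ker g$ and $\alpha_1(\lambda(S)):\operatorname{coker}h_0\to\operatorname{coker}h_1$ are the induced maps. The symbol $\mathbb V$ stands for the paper's upside-down $\mathbb A$. *)

(* Defs.v *)
From Stdlib Require Import ssreflect ssrfun ProofIrrelevance FunctionalExtensionality.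

Set Implicit Arguments.
Set Primitive Projections.
Unset Strict Implicit.
Unset Printing Implicit Defensive.

(* Equality of two arrows (or 2-cells) whose sources and targets are equal
   only propositionally: [heq x y] holds iff the indices of [x] and [y] are
   equal and [x] is transported to [y]. *)
Inductive heq (I : Type) (P : I -> I -> Type) (i j : I) (x : P i j) :
  forall k l, P k l -> Prop := heq_refl : heq x x.

Arguments heq {I P i j} x {k l} y.
Arguments heq_refl {I P i j x}.

Lemma heq_sym I (P : I -> I -> Type) i j k l (x : P i j) (y : P k l) :
  heq x y -> heq y x.
Proof. by move=> h; destruct h. Qed.

Lemma heq_trans I (P : I -> I -> Type) i j k l m n
  (x : P i j) (y : P k l) (z : P m n) : heq x y -> heq y z -> heq x z.
Proof. by move=> h; destruct h. Qed.

Lemma eq_heq I (P : I -> I -> Type) i j (x y : P i j) : x = y -> heq x y.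
Proof. by move=> ->; exact: heq_refl. Qed.

Lemma heq_inv I (P : I -> I -> Type) i j k l (x : P i j) (y : P k l) :
  heq x y -> exists (ei : i = k) (ej : j = l),
    eq_rect j (P k) (eq_rect i (fun i => P i j) x k ei) l ej = y.
Proof. by move=> h; destruct h; exists eq_refl, eq_refl. Qed.

Lemma heq_eq I (P : I -> I -> Type) i j (x y : P i j) : heq x y -> x = y.
Proof.
move=> h; have [ei [ej <-]] := heq_inv h.
by rewrite (proof_irrelevance _ ei eq_refl) (proof_irrelevance _ ej eq_refl).
Qed.

Lemma heq_src I (P : I -> I -> Type) i j k l (x : P i j) (y : P k l) :
  heq x y -> i = k.
Proof. by move=> h; destruct h. Qed.

Lemma heq_tgt I (P : I -> I -> Type) i j k l (x : P i j) (y : P k l) :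
  heq x y -> j = l.
Proof. by move=> h; destruct h. Qed.

(* Strict 2-categories, presented by vertical composition and whiskering. *)
Record TwoCat := {
  cell0 :> Type;
  cell1 : cell0 -> cell0 -> Type;
  cell2 : forall A B, cell1 A B -> cell1 A B -> Type;
  id1 : forall A, cell1 A A;
  comp1 : forall A B C, cell1 B C -> cell1 A B -> cell1 A C;
  id2 : forall A B (f : cell1 A B), cell2 f f;
  vcomp : forall A B (f g h : cell1 A B), cell2 g h -> cell2 f g -> cell2 f h;
  lwhisk : forall A B C (k : cell1 B C) (f g : cell1 A B),
    cell2 f g -> cell2 (comp1 k f) (comp1 k g);
  rwhisk : forall A B C (f g : cell1 B C),
    cell2 f g -> forall k : cell1 A B, cell2 (comp1 f k) (comp1 g k);
  comp1_assoc : forall A B C D (h : cell1 C D) (g : cell1 B C) (f : cell1 A B),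
    comp1 (comp1 h g) f = comp1 h (comp1 g f);
  comp1_idl : forall A B (f : cell1 A B), comp1 (id1 B) f = f;
  comp1_idr : forall A B (f : cell1 A B), comp1 f (id1 A) = f;
  vcomp_assoc : forall A B (f g h k : cell1 A B)
    (r : cell2 h k) (s : cell2 g h) (t : cell2 f g),
    vcomp (vcomp r s) t = vcomp r (vcomp s t);
  vcomp_idl : forall A B (f g : cell1 A B) (t : cell2 f g), vcomp (id2 g) t = t;
  vcomp_idr : forall A B (f g : cell1 A B) (t : cell2 f g), vcomp t (id2 f) = t;
  lwhisk_id2 : forall A B C (k : cell1 B C) (f : cell1 A B),
    lwhisk k (id2 f) = id2 (comp1 k f);
  rwhisk_id2 : forall A B C (f : cell1 B C) (k : cell1 A B),
    rwhisk (id2 f) k = id2 (comp1 f k);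
  lwhisk_vcomp : forall A B C (k : cell1 B C) (f g h : cell1 A B)
    (s : cell2 g h) (t : cell2 f g),
    lwhisk k (vcomp s t) = vcomp (lwhisk k s) (lwhisk k t);
  rwhisk_vcomp : forall A B C (f g h : cell1 B C)
    (s : cell2 g h) (t : cell2 f g) (k : cell1 A B),
    rwhisk (vcomp s t) k = vcomp (rwhisk s k) (rwhisk t k);
  lwhisk_id1 : forall A B (f g : cell1 A B) (t : cell2 f g),
    heq (lwhisk (id1 B) t) t;
  rwhisk_id1 : forall A B (f g : cell1 A B) (t : cell2 f g),
    heq (rwhisk t (id1 A)) t;
  lwhisk_comp1 : forall A B C D (k : cell1 C D) (h : cell1 B C)
    (f g : cell1 A B) (t : cell2 f g),
    heq (lwhisk (comp1 k h) t) (lwhisk k (lwhisk h t));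
  rwhisk_comp1 : forall A B C D (f g : cell1 C D) (t : cell2 f g)
    (h : cell1 B C) (k : cell1 A B),
    heq (rwhisk t (comp1 h k)) (rwhisk (rwhisk t h) k);
  lrwhisk : forall A B C D (h : cell1 C D) (f g : cell1 B C)
    (t : cell2 f g) (k : cell1 A B),
    heq (rwhisk (lwhisk h t) k) (lwhisk h (rwhisk t k));
  interchange : forall A B C (f f' : cell1 A B) (g g' : cell1 B C)
    (t : cell2 f f') (s : cell2 g g'),
    vcomp (rwhisk s f') (lwhisk g t) = vcomp (lwhisk g' t) (rwhisk s f)
}.

Notation "g ∘ f" := (comp1 g f) (at level 41, right associativity).
Notation "k ◃ t" := (lwhisk k t) (at level 42, right associativity).
Notation "t ▹ k" := (rwhisk t k) (at level 43, left associativity).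
Notation "s □ t" := (vcomp s t) (at level 45, right associativity).

(* Vertical composition of 2-cells whose common boundary is a pair of 1-cells
   that are equal, but not syntactically so. *)
Definition vcomp_along (K : TwoCat) (A B : K) (f g g' h : cell1 A B)
  (s : cell2 g' h) (e : g = g') (t : cell2 f g) : cell2 f h :=
  s □ eq_rect g (fun k => cell2 f k) t g' e.

Notation "s □[ e ] t" := (vcomp_along s e t)
  (at level 45, e at level 200, right associativity).

Lemma comp1_reassoc (K : TwoCat) (A B C : K)
  (g : cell1 B C) (f : cell1 A B) (h : cell1 A C) (e : g ∘ f = h) :
  forall Z (k : cell1 Z A), g ∘ f ∘ k = h ∘ k.
Proof. by move=> Z k; rewrite -e comp1_assoc. Qed.

Lemma heq_lwhisk (K : TwoCat) (A B C : K) (k k' : cell1 B C)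
  (f g f' g' : cell1 A B) (t : cell2 f g) (t' : cell2 f' g') :
  k = k' -> heq t t' -> heq (k ◃ t) (k' ◃ t').
Proof. by move=> -> h; destruct h; exact: heq_refl. Qed.

Lemma heq_rwhisk (K : TwoCat) (A B C : K) (k k' : cell1 A B)
  (f g f' g' : cell1 B C) (t : cell2 f g) (t' : cell2 f' g') :
  heq t t' -> k = k' -> heq (t ▹ k) (t' ▹ k').
Proof. by move=> h ->; destruct h; exact: heq_refl. Qed.

Lemma heq_id2 (K : TwoCat) (A B : K) (f g : cell1 A B) :
  f = g -> heq (id2 f) (id2 g).
Proof. by move=> ->; exact: heq_refl. Qed.

Lemma heq_vcomp (K : TwoCat) (A B : K) (f g h f' g' h' : cell1 A B)
  (s : cell2 g h) (t : cell2 f g) (s' : cell2 g' h') (t' : cell2 f' g') :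
  heq s s' -> heq t t' -> heq (s □ t) (s' □ t').
Proof.
move=> hs ht.
have eg := heq_src hs; have eh := heq_tgt hs; have ef := heq_src ht.
move: s' t' hs ht; rewrite -eg -eh -ef => s' t' hs ht.
by rewrite (heq_eq hs) (heq_eq ht); exact: heq_refl.
Qed.

Record TwoFunctor (K L : TwoCat) := {
  tf0 :> K -> L;
  tf1 : forall A B, cell1 A B -> cell1 (tf0 A) (tf0 B);
  tf2 : forall A B (f g : cell1 A B), cell2 f g -> cell2 (tf1 f) (tf1 g);
  tf1_id : forall A, tf1 (id1 A) = id1 (tf0 A);
  tf1_comp : forall A B C (g : cell1 B C) (f : cell1 A B),
    tf1 (g ∘ f) = tf1 g ∘ tf1 f;
  tf2_id : forall A B (f : cell1 A B), tf2 (id2 f) = id2 (tf1 f);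
  tf2_vcomp : forall A B (f g h : cell1 A B) (s : cell2 g h) (t : cell2 f g),
    tf2 (s □ t) = tf2 s □ tf2 t;
  tf2_lwhisk : forall A B C (k : cell1 B C) (f g : cell1 A B) (t : cell2 f g),
    heq (tf2 (k ◃ t)) (tf1 k ◃ tf2 t);
  tf2_rwhisk : forall A B C (f g : cell1 B C) (t : cell2 f g) (k : cell1 A B),
    heq (tf2 (t ▹ k)) (tf2 t ▹ tf1 k)
}.

Arguments tf1 {K L} _ {A B} _.
Arguments tf2 {K L} _ {A B f g} _.

Lemma heq_tf2 (K L : TwoCat) (T : TwoFunctor K L) (A B : K)
  (f g f' g' : cell1 A B) (t : cell2 f g) (t' : cell2 f' g') :
  heq t t' -> heq (tf2 T t) (tf2 T t').
Proof. by move=> h; destruct h; exact: heq_refl. Qed.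

Record TwoMonad (K : TwoCat) := {
  tm_fun :> TwoFunctor K K;
  mu : forall A, cell1 (tm_fun (tm_fun A)) (tm_fun A);
  eta : forall A, cell1 A (tm_fun A);
  mu_nat1 : forall A B (f : cell1 A B),
    mu B ∘ tf1 tm_fun (tf1 tm_fun f) = tf1 tm_fun f ∘ mu A;
  mu_nat2 : forall A B (f g : cell1 A B) (t : cell2 f g),
    heq (mu B ◃ tf2 tm_fun (tf2 tm_fun t)) (tf2 tm_fun t ▹ mu A);
  eta_nat1 : forall A B (f : cell1 A B), eta B ∘ f = tf1 tm_fun f ∘ eta A;
  eta_nat2 : forall A B (f g : cell1 A B) (t : cell2 f g),
    heq (eta B ◃ t) (tf2 tm_fun t ▹ eta A);
  mu_mu : forall A, mu A ∘ tf1 tm_fun (mu A) = mu A ∘ mu (tm_fun A);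
  mu_eta : forall A, mu A ∘ eta (tm_fun A) = id1 (tm_fun A);
  mu_tfeta : forall A, mu A ∘ tf1 tm_fun (eta A) = id1 (tm_fun A)
}.

Record TwoComonad (K : TwoCat) := {
  tc_fun :> TwoFunctor K K;
  eps : forall A, cell1 (tc_fun A) A;
  delta : forall A, cell1 (tc_fun A) (tc_fun (tc_fun A));
  eps_nat1 : forall A B (f : cell1 A B), eps B ∘ tf1 tc_fun f = f ∘ eps A;
  eps_nat2 : forall A B (f g : cell1 A B) (t : cell2 f g),
    heq (eps B ◃ tf2 tc_fun t) (t ▹ eps A);
  delta_nat1 : forall A B (f : cell1 A B),
    delta B ∘ tf1 tc_fun f = tf1 tc_fun (tf1 tc_fun f) ∘ delta A;
  delta_nat2 : forall A B (f g : cell1 A B) (t : cell2 f g),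
    heq (delta B ◃ tf2 tc_fun t) (tf2 tc_fun (tf2 tc_fun t) ▹ delta A);
  delta_delta : forall A,
    tf1 tc_fun (delta A) ∘ delta A = delta (tc_fun A) ∘ delta A;
  eps_delta : forall A, eps (tc_fun A) ∘ delta A = id1 (tc_fun A);
  tfeps_delta : forall A, tf1 tc_fun (eps A) ∘ delta A = id1 (tc_fun A)
}.

(* Invertible distributive law of 2-monads T S => S T. *)
Record MonadDistLaw (K : TwoCat) (T S : TwoMonad K) := {
  mlam : forall A, cell1 (T (S A)) (S (T A));
  mlam_inv : forall A, cell1 (S (T A)) (T (S A));
  mlam_invl : forall A, mlam_inv A ∘ mlam A = id1 _;
  mlam_invr : forall A, mlam A ∘ mlam_inv A = id1 _;
  mlam_nat1 : forall A B (f : cell1 A B),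
    mlam B ∘ tf1 T (tf1 S f) = tf1 S (tf1 T f) ∘ mlam A;
  mlam_nat2 : forall A B (f g : cell1 A B) (t : cell2 f g),
    heq (mlam B ◃ tf2 T (tf2 S t)) (tf2 S (tf2 T t) ▹ mlam A);
  mlam_etal : forall A, mlam A ∘ eta T (S A) = tf1 S (eta T A);
  mlam_etar : forall A, mlam A ∘ tf1 T (eta S A) = eta S (T A);
  mlam_mul : forall A,
    mlam A ∘ mu T (S A) = tf1 S (mu T A) ∘ mlam (T A) ∘ tf1 T (mlam A);
  mlam_mur : forall A,
    mlam A ∘ tf1 T (mu S A) = mu S (T A) ∘ tf1 S (mlam A) ∘ mlam (S A)
}.

(* Invertible distributive law of 2-comonads V A => A V. *)
Record ComonadDistLaw (K : TwoCat) (V A : TwoComonad K) := {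
  lam : forall X, cell1 (V (A X)) (A (V X));
  lam_inv : forall X, cell1 (A (V X)) (V (A X));
  lam_invl : forall X, lam_inv X ∘ lam X = id1 _;
  lam_invr : forall X, lam X ∘ lam_inv X = id1 _;
  lam_nat1 : forall X Y (f : cell1 X Y),
    lam Y ∘ tf1 V (tf1 A f) = tf1 A (tf1 V f) ∘ lam X;
  lam_nat2 : forall X Y (f g : cell1 X Y) (t : cell2 f g),
    heq (lam Y ◃ tf2 V (tf2 A t)) (tf2 A (tf2 V t) ▹ lam X);
  lam_epsV : forall X, tf1 A (eps V X) ∘ lam X = eps V (A X);
  lam_epsA : forall X, eps A (V X) ∘ lam X = tf1 V (eps A X);
  lam_deltaV : forall X,
    tf1 A (delta V X) ∘ lam X = lam (V X) ∘ tf1 V (lam X) ∘ delta V (A X);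
  lam_deltaA : forall X,
    delta A (V X) ∘ lam X = tf1 A (lam X) ∘ lam (A X) ∘ tf1 V (delta A X)
}.

(* Objects (C, β^C, β_C) with [bup] = β^C a V-coalgebra and [bdn] = β_C an
   A-coalgebra, compatible along the distributive law. *)
Record BiCoalgebra (K : TwoCat) (V A : TwoComonad K)
    (L : ComonadDistLaw V A) := {
  bc_car :> K;
  bup : cell1 bc_car (V bc_car);
  bdn : cell1 bc_car (A bc_car);
  bup_eps : eps V bc_car ∘ bup = id1 bc_car;
  bup_delta : tf1 V bup ∘ bup = delta V bc_car ∘ bup;
  bdn_eps : eps A bc_car ∘ bdn = id1 bc_car;
  bdn_delta : tf1 A bdn ∘ bdn = delta A bc_car ∘ bdn;
  bup_bdn : lam L bc_car ∘ tf1 V bdn ∘ bup = tf1 A bup ∘ bdn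
}.

Record CoalgMap (K : TwoCat) (V A : TwoComonad K) (L : ComonadDistLaw V A)
    (X Y : BiCoalgebra L) := {
  cm1 :> cell1 (bc_car X) (bc_car Y);
  cm1_up : tf1 V cm1 ∘ bup X = bup Y ∘ cm1;
  cm1_dn : tf1 A cm1 ∘ bdn X = bdn Y ∘ cm1
}.

Record CoalgCell (K : TwoCat) (V A : TwoComonad K) (L : ComonadDistLaw V A)
    (X Y : BiCoalgebra L) (f g : CoalgMap X Y) := {
  cm2 :> cell2 (cm1 f) (cm1 g);
  cm2_up : heq (tf2 V cm2 ▹ bup X) (bup Y ◃ cm2);
  cm2_dn : heq (tf2 A cm2 ▹ bdn X) (bdn Y ◃ cm2)
}.

Lemma CoalgMap_eq (K : TwoCat) (V A : TwoComonad K) (L : ComonadDistLaw V A)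
  (X Y : BiCoalgebra L) (f g : CoalgMap X Y) : cm1 f = cm1 g -> f = g.
Proof.
destruct f as [f f1 f2]; destruct g as [g g1 g2] => /= e; subst g.
by rewrite (proof_irrelevance _ f1 g1) (proof_irrelevance _ f2 g2).
Qed.

Lemma CoalgCell_eq (K : TwoCat) (V A : TwoComonad K) (L : ComonadDistLaw V A)
  (X Y : BiCoalgebra L) (f g : CoalgMap X Y) (s t : CoalgCell f g) :
  cm2 s = cm2 t -> s = t.
Proof.
destruct s as [f' f1 f2]; destruct t as [g' g1 g2] => /= e; subst g'.
by rewrite (proof_irrelevance _ f1 g1) (proof_irrelevance _ f2 g2).
Qed.

Lemma CoalgCell_heq (K : TwoCat) (V A : TwoComonad K) (L : ComonadDistLaw V A)
  (X Y : BiCoalgebra L) (f g f' g' : CoalgMap X Y)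
  (s : CoalgCell f g) (t : CoalgCell f' g') :
  heq (cm2 s) (cm2 t) -> heq s t.
Proof.
move=> h; have ef := CoalgMap_eq (heq_src h); have eg := CoalgMap_eq (heq_tgt h).
subst f' g'; apply: eq_heq; apply: CoalgCell_eq; exact: heq_eq h.
Qed.

Lemma CoalgCell_heqP (K : TwoCat) (V A : TwoComonad K) (L : ComonadDistLaw V A)
  (X Y : BiCoalgebra L) (f g f' g' : CoalgMap X Y)
  (s : CoalgCell f g) (t : CoalgCell f' g') :
  heq s t -> heq (cm2 s) (cm2 t).
Proof. by move=> h; destruct h; exact: heq_refl. Qed.

Definition coalg_id1 (K : TwoCat) (V A : TwoComonad K) (L : ComonadDistLaw V A)
  (X : BiCoalgebra L) : CoalgMap X X.
Proof.
exists (id1 (bc_car X)); by rewrite tf1_id comp1_idl comp1_idr.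
Defined.

Definition coalg_comp1 (K : TwoCat) (V A : TwoComonad K)
  (L : ComonadDistLaw V A) (X Y Z : BiCoalgebra L)
  (g : CoalgMap Y Z) (f : CoalgMap X Y) : CoalgMap X Z.
Proof.
exists (cm1 g ∘ cm1 f).
- by rewrite tf1_comp comp1_assoc cm1_up -!comp1_assoc cm1_up.
- by rewrite tf1_comp comp1_assoc cm1_dn -!comp1_assoc cm1_dn.
Defined.

Definition coalg_id2 (K : TwoCat) (V A : TwoComonad K) (L : ComonadDistLaw V A)
  (X Y : BiCoalgebra L) (f : CoalgMap X Y) : CoalgCell f f.
Proof.
exists (id2 (cm1 f)).
- rewrite tf2_id rwhisk_id2 lwhisk_id2; apply: heq_id2; exact: cm1_up.
- rewrite tf2_id rwhisk_id2 lwhisk_id2; apply: heq_id2; exact: cm1_dn.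
Defined.

Definition coalg_vcomp (K : TwoCat) (V A : TwoComonad K)
  (L : ComonadDistLaw V A) (X Y : BiCoalgebra L) (f g h : CoalgMap X Y)
  (s : CoalgCell g h) (t : CoalgCell f g) : CoalgCell f h.
Proof.
exists (cm2 s □ cm2 t).
- rewrite tf2_vcomp rwhisk_vcomp lwhisk_vcomp; apply: heq_vcomp; exact: cm2_up.
- rewrite tf2_vcomp rwhisk_vcomp lwhisk_vcomp; apply: heq_vcomp; exact: cm2_dn.
Defined.

Lemma lwhisk_coalg (K : TwoCat) (T : TwoFunctor K K) (X Y Z : K)
  (bX : cell1 X (T X)) (bY : cell1 Y (T Y)) (bZ : cell1 Z (T Z))
  (k : cell1 Y Z) (f g : cell1 X Y) (t : cell2 f g) :
  tf1 T k ∘ bY = bZ ∘ k -> heq (tf2 T t ▹ bX) (bY ◃ t) ->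
  heq (tf2 T (k ◃ t) ▹ bX) (bZ ◃ (k ◃ t)).
Proof.
move=> e h.
apply: heq_trans; first by apply: heq_rwhisk; [exact: tf2_lwhisk|reflexivity].
apply: heq_trans; first exact: lrwhisk.
apply: heq_trans; first by apply: heq_lwhisk; [reflexivity|exact: h].
apply: heq_trans; first by apply: heq_sym; exact: lwhisk_comp1.
apply: heq_trans; last exact: lwhisk_comp1.
by apply: heq_lwhisk => //; exact: heq_refl.
Qed.

Lemma rwhisk_coalg (K : TwoCat) (T : TwoFunctor K K) (X Y Z : K)
  (bX : cell1 X (T X)) (bY : cell1 Y (T Y)) (bZ : cell1 Z (T Z))
  (k : cell1 X Y) (f g : cell1 Y Z) (t : cell2 f g) :
  tf1 T k ∘ bX = bY ∘ k -> heq (tf2 T t ▹ bY) (bZ ◃ t) ->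
  heq (tf2 T (t ▹ k) ▹ bX) (bZ ◃ (t ▹ k)).
Proof.
move=> e h.
apply: heq_trans; first by apply: heq_rwhisk; [exact: tf2_rwhisk|reflexivity].
apply: heq_trans; first by apply: heq_sym; exact: rwhisk_comp1.
apply: heq_trans; last exact: lrwhisk.
apply: heq_trans; last by apply: heq_rwhisk; [exact: h|reflexivity].
apply: heq_trans; last exact: rwhisk_comp1.
by apply: heq_rwhisk => //; exact: heq_refl.
Qed.

Definition coalg_lwhisk (K : TwoCat) (V A : TwoComonad K)
  (L : ComonadDistLaw V A) (X Y Z : BiCoalgebra L) (k : CoalgMap Y Z)
  (f g : CoalgMap X Y) (t : CoalgCell f g) :
  CoalgCell (coalg_comp1 k f) (coalg_comp1 k g).
Proof.
exists (cm1 k ◃ cm2 t).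
- apply: lwhisk_coalg; [exact: cm1_up|exact: cm2_up].
- apply: lwhisk_coalg; [exact: cm1_dn|exact: cm2_dn].
Defined.

Definition coalg_rwhisk (K : TwoCat) (V A : TwoComonad K)
  (L : ComonadDistLaw V A) (X Y Z : BiCoalgebra L)
  (f g : CoalgMap Y Z) (t : CoalgCell f g) (k : CoalgMap X Y) :
  CoalgCell (coalg_comp1 f k) (coalg_comp1 g k).
Proof.
exists (cm2 t ▹ cm1 k).
- apply: rwhisk_coalg; [exact: cm1_up|exact: cm2_up].
- apply: rwhisk_coalg; [exact: cm1_dn|exact: cm2_dn].
Defined.

Definition CoalgCat (K : TwoCat) (V A : TwoComonad K)
  (L : ComonadDistLaw V A) : TwoCat.
Proof.
refine (@Build_TwoCat (BiCoalgebra L) (@CoalgMap K V A L) (@CoalgCell K V A L)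
  (@coalg_id1 K V A L) (@coalg_comp1 K V A L) (@coalg_id2 K V A L)
  (@coalg_vcomp K V A L) (@coalg_lwhisk K V A L) (@coalg_rwhisk K V A L)
  _ _ _ _ _ _ _ _ _ _ _ _ _ _ _ _); intros;
  first [apply: CoalgMap_eq | apply: CoalgCell_eq | apply: CoalgCell_heq];
  rewrite /=.
- exact: comp1_assoc.
- exact: comp1_idl.
- exact: comp1_idr.
- exact: vcomp_assoc.
- exact: vcomp_idl.
- exact: vcomp_idr.
- exact: lwhisk_id2.
- exact: rwhisk_id2.
- exact: lwhisk_vcomp.
- exact: rwhisk_vcomp.
- exact: lwhisk_id1.
- exact: rwhisk_id1.
- exact: lwhisk_comp1.
- exact: rwhisk_comp1.
- exact: lrwhisk.
- exact: interchange.
Defined.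

(* T_1 (C, β^C, β_C) = (V C, δ^C, λ · V β_C). *)
Definition T1_ob (K : TwoCat) (V A : TwoComonad K) (L : ComonadDistLaw V A)
  (X : BiCoalgebra L) : BiCoalgebra L.
Proof.
refine (@Build_BiCoalgebra K V A L (V X) (delta V X)
  (lam L X ∘ tf1 V (bdn X)) _ _ _ _ _).
- exact: eps_delta.
- exact: delta_delta.
- by rewrite -comp1_assoc lam_epsA -tf1_comp bdn_eps tf1_id.
- rewrite tf1_comp (comp1_reassoc (lam_deltaA L _)) !comp1_assoc.
  rewrite (comp1_reassoc (esym (lam_nat1 L _))) !comp1_assoc.
  by rewrite -!tf1_comp bdn_delta.
- rewrite tf1_comp !comp1_assoc -delta_nat1.
  by rewrite (comp1_reassoc (lam_deltaV L _)) !comp1_assoc.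
Defined.

Lemma lam_inv_epsV (K : TwoCat) (V A : TwoComonad K) (L : ComonadDistLaw V A)
  (X : K) : eps V (A X) ∘ lam_inv L X = tf1 A (eps V X).
Proof. by rewrite -(lam_epsV L) comp1_assoc lam_invr comp1_idr. Qed.

Lemma lam_inv_nat1 (K : TwoCat) (V A : TwoComonad K) (L : ComonadDistLaw V A)
  (X Y : K) (f : cell1 X Y) :
  lam_inv L Y ∘ tf1 A (tf1 V f) = tf1 V (tf1 A f) ∘ lam_inv L X.
Proof.
rewrite -[LHS]comp1_idr -(lam_invr L) !comp1_assoc.
rewrite (comp1_reassoc (esym (lam_nat1 L f))) !comp1_assoc.
by rewrite (comp1_reassoc (lam_invl L _)) comp1_idl.
Qed.

Lemma lam_inv_deltaV (K : TwoCat) (V A : TwoComonad K)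
  (L : ComonadDistLaw V A) (X : K) :
  delta V (A X) ∘ lam_inv L X =
  tf1 V (lam_inv L X) ∘ lam_inv L (V X) ∘ tf1 A (delta V X).
Proof.
rewrite -[tf1 A (delta V X)]comp1_idr -(lam_invr L).
rewrite (comp1_reassoc (lam_deltaV L X)) !comp1_assoc.
rewrite (comp1_reassoc (lam_invl L _)) comp1_idl.
by rewrite -(comp1_assoc (tf1 V _)) -tf1_comp lam_invl tf1_id comp1_idl.
Qed.

Lemma lam_inv_deltaA (K : TwoCat) (V A : TwoComonad K)
  (L : ComonadDistLaw V A) (X : K) :
  tf1 V (delta A X) ∘ lam_inv L X =
  lam_inv L (A X) ∘ tf1 A (lam_inv L X) ∘ delta A (V X).
Proof.
rewrite -[delta A (V X)]comp1_idr -(lam_invr L).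
rewrite (comp1_reassoc (lam_deltaA L X)) !comp1_assoc.
rewrite -(comp1_assoc (tf1 A _)) -tf1_comp lam_invl tf1_id comp1_idl.
by rewrite (comp1_reassoc (lam_invl L _)) comp1_idl.
Qed.

(* T_2 (C, β^C, β_C) = (A C, λ^{-1} · A β^C, δ_C). *)
Definition T2_ob (K : TwoCat) (V A : TwoComonad K) (L : ComonadDistLaw V A)
  (X : BiCoalgebra L) : BiCoalgebra L.
Proof.
refine (@Build_BiCoalgebra K V A L (A X) (lam_inv L X ∘ tf1 A (bup X))
  (delta A X) _ _ _ _ _).
- by rewrite -comp1_assoc lam_inv_epsV -tf1_comp bup_eps tf1_id.
- rewrite tf1_comp !comp1_assoc (comp1_reassoc (esym (lam_inv_nat1 L _))).
  rewrite !comp1_assoc -tf1_comp bup_delta tf1_comp.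
  by rewrite (comp1_reassoc (lam_inv_deltaV L _)) !comp1_assoc.
- exact: eps_delta.
- exact: delta_delta.
- rewrite (comp1_reassoc (lam_inv_deltaA L _)) !comp1_assoc.
  rewrite delta_nat1 (comp1_reassoc (lam_invr L _)) comp1_idl.
  by rewrite tf1_comp !comp1_assoc.
Defined.

Definition T1_map (K : TwoCat) (V A : TwoComonad K) (L : ComonadDistLaw V A)
  (X Y : BiCoalgebra L) (f : CoalgMap X Y) : CoalgMap (T1_ob X) (T1_ob Y).
Proof.
exists (tf1 V (cm1 f)); rewrite /=.
- by rewrite delta_nat1.
- rewrite (comp1_reassoc (esym (lam_nat1 L _))) !comp1_assoc -!tf1_comp.
  by rewrite cm1_dn.
Defined.

Definition T2_map (K : TwoCat) (V A : TwoComonad K) (L : ComonadDistLaw V A)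
  (X Y : BiCoalgebra L) (f : CoalgMap X Y) : CoalgMap (T2_ob X) (T2_ob Y).
Proof.
exists (tf1 A (cm1 f)); rewrite /=.
- rewrite (comp1_reassoc (esym (lam_inv_nat1 L _))) !comp1_assoc -!tf1_comp.
  by rewrite cm1_up.
- by rewrite delta_nat1.
Defined.

Lemma cell_coalg_comp (K : TwoCat) (F T : TwoFunctor K K)
  (X Y : K)
  (bX : cell1 X (T X)) (bY : cell1 Y (T Y)) (f g : cell1 X Y) (t : cell2 f g)
  (lX : cell1 (F (T X)) (T (F X))) (lY : cell1 (F (T Y)) (T (F Y))) :
  heq (lY ◃ tf2 F (tf2 T t)) (tf2 T (tf2 F t) ▹ lX) ->
  heq (tf2 T t ▹ bX) (bY ◃ t) ->
  heq (tf2 T (tf2 F t) ▹ (lX ∘ tf1 F bX)) ((lY ∘ tf1 F bY) ◃ tf2 F t).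
Proof.
move=> hl hb.
apply: heq_trans; first exact: rwhisk_comp1.
apply: heq_trans; first by apply: heq_rwhisk; [apply: heq_sym; exact: hl|].
apply: heq_trans; first exact: lrwhisk.
apply: heq_trans; last by apply: heq_sym; exact: lwhisk_comp1.
apply: heq_lwhisk => //.
apply: heq_trans; first by apply: heq_sym; exact: tf2_rwhisk.
apply: heq_trans; last exact: tf2_lwhisk.
exact: heq_tf2.
Qed.

Lemma lam_inv_nat2 (K : TwoCat) (V A : TwoComonad K) (L : ComonadDistLaw V A)
  (X Y : K) (f g : cell1 X Y) (t : cell2 f g) :
  heq (lam_inv L Y ◃ tf2 A (tf2 V t)) (tf2 V (tf2 A t) ▹ lam_inv L X).
Proof.
apply: heq_trans; first by apply: heq_sym; exact: rwhisk_id1.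
apply: heq_trans.
  by apply: heq_rwhisk; [exact: heq_refl|symmetry; exact: (lam_invr L)].
apply: heq_trans; first exact: rwhisk_comp1.
apply: heq_rwhisk => //.
apply: heq_trans; first exact: lrwhisk.
apply: heq_trans.
  by apply: heq_lwhisk; [reflexivity|apply: heq_sym; exact: lam_nat2].
apply: heq_trans; first by apply: heq_sym; exact: lwhisk_comp1.
rewrite lam_invl; exact: lwhisk_id1.
Qed.

Definition T1_cell (K : TwoCat) (V A : TwoComonad K) (L : ComonadDistLaw V A)
  (X Y : BiCoalgebra L) (f g : CoalgMap X Y) (t : CoalgCell f g) :
  CoalgCell (T1_map f) (T1_map g).
Proof.
exists (tf2 V (cm2 t)); rewrite /=.
- by apply: heq_sym; exact: delta_nat2.
- apply: cell_coalg_comp; [exact: lam_nat2|exact: cm2_dn].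
Defined.

Definition T2_cell (K : TwoCat) (V A : TwoComonad K) (L : ComonadDistLaw V A)
  (X Y : BiCoalgebra L) (f g : CoalgMap X Y) (t : CoalgCell f g) :
  CoalgCell (T2_map f) (T2_map g).
Proof.
exists (tf2 A (cm2 t)); rewrite /=.
- apply: cell_coalg_comp; [exact: lam_inv_nat2|exact: cm2_up].
- by apply: heq_sym; exact: delta_nat2.
Defined.

Definition T1_fun (K : TwoCat) (V A : TwoComonad K) (L : ComonadDistLaw V A) :
  TwoFunctor (CoalgCat L) (CoalgCat L).
Proof.
refine (@Build_TwoFunctor (CoalgCat L) (CoalgCat L) (@T1_ob K V A L)
  (@T1_map K V A L) (@T1_cell K V A L) _ _ _ _ _ _); intros;
  first [apply: CoalgMap_eq | apply: CoalgCell_eq | apply: CoalgCell_heq];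
  rewrite /=.
- exact: tf1_id.
- exact: tf1_comp.
- exact: tf2_id.
- exact: tf2_vcomp.
- exact: tf2_lwhisk.
- exact: tf2_rwhisk.
Defined.

Definition T2_fun (K : TwoCat) (V A : TwoComonad K) (L : ComonadDistLaw V A) :
  TwoFunctor (CoalgCat L) (CoalgCat L).
Proof.
refine (@Build_TwoFunctor (CoalgCat L) (CoalgCat L) (@T2_ob K V A L)
  (@T2_map K V A L) (@T2_cell K V A L) _ _ _ _ _ _); intros;
  first [apply: CoalgMap_eq | apply: CoalgCell_eq | apply: CoalgCell_heq];
  rewrite /=.
- exact: tf1_id.
- exact: tf1_comp.
- exact: tf2_id.
- exact: tf2_vcomp.
- exact: tf2_lwhisk.
- exact: tf2_rwhisk.
Defined.

(* μ_1 = V ε^C and η_1 = β^C; dually μ_2 = A ε_C and η_2 = β_C. *)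
Definition T1_mu (K : TwoCat) (V A : TwoComonad K) (L : ComonadDistLaw V A)
  (X : BiCoalgebra L) : CoalgMap (T1_ob (T1_ob X)) (T1_ob X).
Proof.
exists (tf1 V (eps V X)); rewrite /=.
- by rewrite delta_nat1.
- rewrite -(comp1_assoc (tf1 A _)) -(lam_nat1 L) comp1_assoc -tf1_comp.
  rewrite (comp1_reassoc (lam_epsV L _)).
  by rewrite eps_nat1 tf1_comp comp1_assoc.
Defined.

Definition T1_eta (K : TwoCat) (V A : TwoComonad K) (L : ComonadDistLaw V A)
  (X : BiCoalgebra L) : CoalgMap X (T1_ob X).
Proof.
exists (bup X); rewrite /=.
- exact: bup_delta.
- by rewrite comp1_assoc bup_bdn.
Defined.

Lemma lam_inv_epsA (K : TwoCat) (V A : TwoComonad K) (L : ComonadDistLaw V A)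
  (X : K) : tf1 V (eps A X) ∘ lam_inv L X = eps A (V X).
Proof. by rewrite -(lam_epsA L) comp1_assoc lam_invr comp1_idr. Qed.

Definition T2_mu (K : TwoCat) (V A : TwoComonad K) (L : ComonadDistLaw V A)
  (X : BiCoalgebra L) : CoalgMap (T2_ob (T2_ob X)) (T2_ob X).
Proof.
exists (tf1 A (eps A X)); rewrite /=.
- rewrite -(comp1_assoc (tf1 V _)) -(lam_inv_nat1 L) comp1_assoc -tf1_comp.
  rewrite (comp1_reassoc (lam_inv_epsA L _)).
  by rewrite eps_nat1 tf1_comp comp1_assoc.
- by rewrite delta_nat1.
Defined.

Definition T2_eta (K : TwoCat) (V A : TwoComonad K) (L : ComonadDistLaw V A)
  (X : BiCoalgebra L) : CoalgMap X (T2_ob X).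
Proof.
exists (bdn X); rewrite /=.
- by rewrite comp1_assoc -bup_bdn -comp1_assoc lam_invl comp1_idl.
- exact: bdn_delta.
Defined.

Lemma tf2_eps_nat2 (K : TwoCat) (T : TwoComonad K) (X Y : K)
  (f g : cell1 X Y) (t : cell2 f g) :
  heq (tf1 T (eps T Y) ◃ tf2 T (tf2 T t)) (tf2 T t ▹ tf1 T (eps T X)).
Proof.
apply: heq_trans; first by apply: heq_sym; exact: tf2_lwhisk.
apply: heq_trans; last exact: tf2_rwhisk.
by apply: heq_tf2; exact: eps_nat2.
Qed.

Definition T1 (K : TwoCat) (V A : TwoComonad K) (L : ComonadDistLaw V A) :
  TwoMonad (CoalgCat L).
Proof.
refine (@Build_TwoMonad (CoalgCat L) (T1_fun L) (@T1_mu K V A L)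
  (@T1_eta K V A L) _ _ _ _ _ _ _); intros;
  first [apply: CoalgMap_eq | apply: CoalgCell_heq]; rewrite /=.
- by rewrite -!tf1_comp eps_nat1.
- exact: tf2_eps_nat2.
- by rewrite cm1_up.
- by apply: heq_sym; exact: cm2_up.
- by rewrite -!tf1_comp eps_nat1.
- exact: tfeps_delta.
- by rewrite -tf1_comp bup_eps tf1_id.
Defined.

Definition T2 (K : TwoCat) (V A : TwoComonad K) (L : ComonadDistLaw V A) :
  TwoMonad (CoalgCat L).
Proof.
refine (@Build_TwoMonad (CoalgCat L) (T2_fun L) (@T2_mu K V A L)
  (@T2_eta K V A L) _ _ _ _ _ _ _); intros;
  first [apply: CoalgMap_eq | apply: CoalgCell_heq]; rewrite /=.
- by rewrite -!tf1_comp eps_nat1.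
- exact: tf2_eps_nat2.
- by rewrite cm1_dn.
- by apply: heq_sym; exact: cm2_dn.
- by rewrite -!tf1_comp eps_nat1.
- exact: tfeps_delta.
- by rewrite -tf1_comp bdn_eps tf1_id.
Defined.

Definition coalg_lam (K : TwoCat) (V A : TwoComonad K)
  (L : ComonadDistLaw V A) (X : BiCoalgebra L) :
  CoalgMap (T1_ob (T2_ob X)) (T2_ob (T1_ob X)).
Proof.
exists (lam L X); rewrite /=.
- rewrite comp1_assoc (lam_deltaV L) -[RHS]comp1_assoc lam_invl.
  by rewrite comp1_idl.
- by rewrite (lam_deltaA L).
Defined.

Definition coalg_lam_inv (K : TwoCat) (V A : TwoComonad K)
  (L : ComonadDistLaw V A) (X : BiCoalgebra L) :
  CoalgMap (T2_ob (T1_ob X)) (T1_ob (T2_ob X)).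
Proof.
exists (lam_inv L X); rewrite /=.
- by rewrite (lam_inv_deltaV L).
- rewrite comp1_assoc (lam_inv_deltaA L) -[RHS]comp1_assoc lam_invr.
  by rewrite comp1_idl.
Defined.

Definition coalg_dist (K : TwoCat) (V A : TwoComonad K)
  (L : ComonadDistLaw V A) : MonadDistLaw (T1 L) (T2 L).
Proof.
refine (@Build_MonadDistLaw (CoalgCat L) (T1 L) (T2 L) (@coalg_lam K V A L)
  (@coalg_lam_inv K V A L) _ _ _ _ _ _ _ _); intros;
  first [apply: CoalgMap_eq | apply: CoalgCell_heq]; rewrite /=.
- exact: lam_invl.
- exact: lam_invr.
- exact: lam_nat1.
- exact: lam_nat2.
- by rewrite -comp1_assoc lam_invr comp1_idl.
- by [].
- rewrite -(comp1_assoc (tf1 A _)) -(lam_nat1 L) comp1_assoc -tf1_comp.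
  by rewrite (lam_epsV L).
- rewrite -comp1_assoc -tf1_comp (lam_epsA L).
  by rewrite (lam_nat1 L).
Defined.

Lemma alg_bd_nat (K : TwoCat) (T : TwoMonad K) (X : K) (a : cell1 (T X) X) :
  (a ∘ mu T X) ∘ tf1 T (tf1 T a) = (a ∘ tf1 T a) ∘ mu T (T X).
Proof. by rewrite !comp1_assoc mu_nat1. Qed.

Lemma alg_bd_mu (K : TwoCat) (T : TwoMonad K) (X : K) (a : cell1 (T X) X) :
  a ∘ tf1 T (a ∘ mu T X) = (a ∘ tf1 T a) ∘ tf1 T (mu T X).
Proof. by rewrite tf1_comp comp1_assoc. Qed.

(* Normalized lax and colax algebra structures on a fixed object. *)
Record LaxAlgebra (K : TwoCat) (T : TwoMonad K) (X : K) := {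
  lax_map : cell1 (T X) X;
  lax_cell : cell2 (lax_map ∘ tf1 T lax_map) (lax_map ∘ mu T X);
  lax_map_eta : lax_map ∘ eta T X = id1 X;
  lax_cell_tfeta : heq (lax_cell ▹ tf1 T (eta T X)) (id2 lax_map);
  lax_cell_eta : heq (lax_cell ▹ eta T (T X)) (id2 lax_map);
  lax_assoc :
    heq ((lax_cell ▹ mu T (T X)) □[alg_bd_nat lax_map]
           (lax_cell ▹ tf1 T (tf1 T lax_map)))
        ((lax_cell ▹ tf1 T (mu T X)) □[alg_bd_mu lax_map]
           (lax_map ◃ tf2 T lax_cell))
}.

Record ColaxAlgebra (K : TwoCat) (T : TwoMonad K) (X : K) := {
  colax_map : cell1 (T X) X;
  colax_cell : cell2 (colax_map ∘ mu T X) (colax_map ∘ tf1 T colax_map);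
  colax_map_eta : colax_map ∘ eta T X = id1 X;
  colax_cell_tfeta : heq (colax_cell ▹ tf1 T (eta T X)) (id2 colax_map);
  colax_cell_eta : heq (colax_cell ▹ eta T (T X)) (id2 colax_map);
  colax_assoc :
    heq ((colax_cell ▹ tf1 T (tf1 T colax_map))
           □[eq_sym (alg_bd_nat colax_map)] (colax_cell ▹ mu T (T X)))
        ((colax_map ◃ tf2 T colax_cell)
           □[eq_sym (alg_bd_mu colax_map)] (colax_cell ▹ tf1 T (mu T X)))
}.

Lemma rule_bd_a1 (K : TwoCat) (T S : TwoMonad K) (D : MonadDistLaw T S) (X : K)
  (a1 : cell1 (T X) X) (a2 : cell1 (S X) X) :
  (a2 ∘ tf1 S a1 ∘ mlam D X) ∘ tf1 T (tf1 S a2) =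
  (a2 ∘ tf1 S (a1 ∘ tf1 T a2)) ∘ mlam D (S X).
Proof. by rewrite tf1_comp !comp1_assoc mlam_nat1. Qed.

Lemma rule_bd_a2 (K : TwoCat) (T S : TwoMonad K) (D : MonadDistLaw T S) (X : K)
  (a1 : cell1 (T X) X) (a2 : cell1 (S X) X) :
  (a2 ∘ tf1 S (a2 ∘ tf1 S a1 ∘ mlam D X)) ∘ mlam D (S X) =
  (a2 ∘ tf1 S a2) ∘ tf1 S (tf1 S a1) ∘ tf1 S (mlam D X) ∘ mlam D (S X).
Proof. by rewrite !tf1_comp !comp1_assoc. Qed.

Lemma rule_bd_a3 (K : TwoCat) (T S : TwoMonad K) (X : K)
  (a1 : cell1 (T X) X) (a2 : cell1 (S X) X) :
  a1 ∘ tf1 T (a2 ∘ mu S X) = (a1 ∘ tf1 T a2) ∘ tf1 T (mu S X).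
Proof. by rewrite tf1_comp comp1_assoc. Qed.

Lemma rule_bd_b1 (K : TwoCat) (T S : TwoMonad K) (X : K)
  (a1 : cell1 (T X) X) (a2 : cell1 (S X) X) :
  (a1 ∘ tf1 T a1) ∘ tf1 T (tf1 T a2) = a1 ∘ tf1 T (a1 ∘ tf1 T a2).
Proof. by rewrite tf1_comp comp1_assoc. Qed.

Lemma rule_bd_b2 (K : TwoCat) (T S : TwoMonad K) (D : MonadDistLaw T S) (X : K)
  (a1 : cell1 (T X) X) (a2 : cell1 (S X) X) :
  a1 ∘ tf1 T (a2 ∘ tf1 S a1 ∘ mlam D X) =
  (a1 ∘ tf1 T a2) ∘ tf1 T (tf1 S a1) ∘ tf1 T (mlam D X).
Proof. by rewrite !tf1_comp comp1_assoc. Qed.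

Lemma rule_bd_b3 (K : TwoCat) (T S : TwoMonad K) (D : MonadDistLaw T S) (X : K)
  (a1 : cell1 (T X) X) (a2 : cell1 (S X) X) :
  (a2 ∘ tf1 S a1 ∘ mlam D X) ∘ mu T (S X) =
  (a2 ∘ tf1 S (a1 ∘ mu T X)) ∘ mlam D (T X) ∘ tf1 T (mlam D X).
Proof. by rewrite tf1_comp !comp1_assoc mlam_mul. Qed.

Record is_mixed_lax_rule (K : TwoCat) (T S : TwoMonad K)
    (D : MonadDistLaw T S) (X : K) (A1 : ColaxAlgebra T X)
    (A2 : LaxAlgebra S X)
    (psi : cell2 (colax_map A1 ∘ tf1 T (lax_map A2))
                 (lax_map A2 ∘ tf1 S (colax_map A1) ∘ mlam D X)) : Prop := {
  mixed_rule_a :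
    heq ((lax_cell A2 ▹ (tf1 S (tf1 S (colax_map A1)) ∘ tf1 S (mlam D X)
                           ∘ mlam D (S X)))
           □[rule_bd_a2 D (colax_map A1) (lax_map A2)]
         ((lax_map A2 ◃ tf2 S psi) ▹ mlam D (S X))
           □[rule_bd_a1 D (colax_map A1) (lax_map A2)]
         (psi ▹ tf1 T (tf1 S (lax_map A2))))
        ((psi ▹ tf1 T (mu S X))
           □[rule_bd_a3 (colax_map A1) (lax_map A2)]
         (colax_map A1 ◃ tf2 T (lax_cell A2)));
  mixed_rule_b :
    heq ((psi ▹ (tf1 T (tf1 S (colax_map A1)) ∘ tf1 T (mlam D X)))
           □[rule_bd_b2 D (colax_map A1) (lax_map A2)]
         (colax_map A1 ◃ tf2 T psi)
           □[rule_bd_b1 (colax_map A1) (lax_map A2)]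
         (colax_cell A1 ▹ tf1 T (tf1 T (lax_map A2))))
        (((lax_map A2 ◃ tf2 S (colax_cell A1))
            ▹ (mlam D (T X) ∘ tf1 T (mlam D X)))
           □[rule_bd_b3 D (colax_map A1) (lax_map A2)]
         (psi ▹ mu T (S X)));
  mixed_rule_c : heq (psi ▹ eta T (S X)) (id2 (lax_map A2));
  mixed_rule_d : heq (psi ▹ tf1 T (eta S X)) (id2 (colax_map A1))
}.

Record Category := {
  Ob :> Type;
  Hom : Ob -> Ob -> Type;
  idm : forall a, Hom a a;
  cmp : forall a b c, Hom b c -> Hom a b -> Hom a c;
  cmp_assoc : forall a b c d (h : Hom c d) (g : Hom b c) (f : Hom a b),
    cmp (cmp h g) f = cmp h (cmp g f);
  cmp_idl : forall a b (f : Hom a b), cmp (idm b) f = f;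
  cmp_idr : forall a b (f : Hom a b), cmp f (idm a) = f
}.

Arguments idm {c0} a.
Notation "g ⋅ f" := (cmp g f) (at level 40, left associativity).

Record Functor (C D : Category) := {
  fob :> C -> D;
  fmap : forall a b, Hom a b -> Hom (fob a) (fob b);
  fmap_id : forall a, fmap (idm a) = idm (fob a);
  fmap_cmp : forall a b c (g : Hom b c) (f : Hom a b),
    fmap (g ⋅ f) = fmap g ⋅ fmap f
}.

Arguments fmap {C D} _ {a b} _.

Record NatTrans (C D : Category) (F G : Functor C D) := {
  ntc :> forall a, Hom (F a) (G a);
  nt_nat : forall a b (f : Hom a b), fmap G f ⋅ ntc a = ntc b ⋅ fmap F f
}.

Lemma Functor_eq (C D : Category) (F G : Functor C D) :
  (forall a b (f : Hom a b), heq (fmap F f) (fmap G f)) -> F = G.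
Proof.
destruct F as [F F1 F2 F3]; destruct G as [G G1 G2 G3] => /= h.
have e : F = G.
  by apply: functional_extensionality => a; exact: heq_src (h a a (idm a)).
subst G.
have e : F1 = G1.
  do 3 (apply: functional_extensionality_dep => ?); exact: heq_eq (h _ _ _).
subst G1.
by rewrite (proof_irrelevance _ F2 G2) (proof_irrelevance _ F3 G3).
Qed.

Lemma NatTrans_eq (C D : Category) (F G : Functor C D) (s t : NatTrans F G) :
  (forall a, s a = t a) -> s = t.
Proof.
destruct s as [s hs]; destruct t as [t ht] => /= h.
have e : s = t by exact: functional_extensionality_dep.
by subst t; rewrite (proof_irrelevance _ hs ht).
Qed.

Lemma NatTrans_heq (C D : Category) (F G F' G' : Functor C D)
  (s : NatTrans F G) (t : NatTrans F' G') :
  F = F' -> G = G' -> (forall a, heq (s a) (t a)) -> heq s t.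
Proof.
move=> eF eG; subst F' G' => h; apply: eq_heq; apply: NatTrans_eq => a.
exact: heq_eq (h a).
Qed.

Lemma NatTrans_heqP (C D : Category) (F G F' G' : Functor C D)
  (s : NatTrans F G) (t : NatTrans F' G') :
  heq s t -> forall a, heq (s a) (t a).
Proof. by move=> h; destruct h => a; exact: heq_refl. Qed.

Definition fun_id (C : Category) : Functor C C :=
  @Build_Functor C C (fun a => a) (fun a b f => f) (fun a => eq_refl)
    (fun a b c g f => eq_refl).

Definition fun_comp (C D E : Category) (G : Functor D E) (F : Functor C D) :
  Functor C E.
Proof.
exists (fun a => G (F a)) (fun a b f => fmap G (fmap F f)) => *.
- by rewrite !fmap_id.
- by rewrite !fmap_cmp.
Defined.

Definition nt_id (C D : Category) (F : Functor C D) : NatTrans F F.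
Proof.
by exists (fun a => idm (F a)) => *; rewrite cmp_idl cmp_idr.
Defined.

Definition nt_vcomp (C D : Category) (F G H : Functor C D)
  (s : NatTrans G H) (t : NatTrans F G) : NatTrans F H.
Proof.
exists (fun a => s a ⋅ t a) => *.
by rewrite -cmp_assoc nt_nat cmp_assoc nt_nat cmp_assoc.
Defined.

Definition nt_lwhisk (C D E : Category) (H : Functor D E) (F G : Functor C D)
  (t : NatTrans F G) : NatTrans (fun_comp H F) (fun_comp H G).
Proof.
exists (fun a => fmap H (t a)) => * /=.
by rewrite -!fmap_cmp nt_nat.
Defined.

Definition nt_rwhisk (C D E : Category) (F G : Functor D E)
  (t : NatTrans F G) (H : Functor C D) :
  NatTrans (fun_comp F H) (fun_comp G H).
Proof. by exists (fun a => t (H a)) => * /=; rewrite nt_nat. Defined.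

Definition Cat : TwoCat.
Proof.
refine (@Build_TwoCat Category Functor NatTrans fun_id fun_comp nt_id
  nt_vcomp nt_lwhisk nt_rwhisk _ _ _ _ _ _ _ _ _ _ _ _ _ _ _ _); intros;
  first [apply: Functor_eq | apply: NatTrans_eq
        | apply: NatTrans_heq; try apply: Functor_eq]; intros;
  rewrite /=; try exact: heq_refl; try reflexivity.
- by rewrite cmp_assoc.
- by rewrite cmp_idl.
- by rewrite cmp_idr.
- by rewrite fmap_id.
- by rewrite fmap_cmp.
- by rewrite nt_nat.
Defined.

Record arrow (C : Category) := Arrow {
  asrc : C; atgt : C; amor : Hom asrc atgt
}.

(* A morphism (h_0, h_1) : f -> g, i.e. a square g h_0 = h_1 f. *)
Record square (C : Category) (f g : arrow C) := Square {
  sq0 : Hom (asrc f) (asrc g);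
  sq1 : Hom (atgt f) (atgt g);
  sq_comm : amor g ⋅ sq0 = sq1 ⋅ amor f
}.

Arguments Arrow {C asrc atgt} amor.
Arguments Square {C f g} sq0 sq1 sq_comm.

Lemma square_eq (C : Category) (f g : arrow C) (s t : square f g) :
  sq0 s = sq0 t -> sq1 s = sq1 t -> s = t.
Proof.
destruct s as [s0 s1 hs]; destruct t as [t0 t1 ht] => /= e0 e1; subst t0 t1.
by rewrite (proof_irrelevance _ hs ht).
Qed.

Lemma arrow_eq (C : Category) (f g : arrow C) :
  heq (amor f) (amor g) -> f = g.
Proof.
by destruct f as [a b f]; destruct g as [c d g] => /= h; destruct h.
Qed.

Lemma square_heq (C : Category) (f g f' g' : arrow C)
  (s : square f g) (t : square f' g') :
  heq (amor f) (amor f') -> heq (amor g) (amor g') ->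
  heq (sq0 s) (sq0 t) -> heq (sq1 s) (sq1 t) -> heq s t.
Proof.
move=> /arrow_eq ef /arrow_eq eg; subst f' g' => h0 h1.
by apply: eq_heq; apply: square_eq; apply: heq_eq.
Qed.

Lemma square_id_comm (C : Category) (f : arrow C) :
  amor f ⋅ idm (asrc f) = idm (atgt f) ⋅ amor f.
Proof. by rewrite cmp_idl cmp_idr. Qed.

Lemma square_cmp_comm (C : Category) (f g h : arrow C)
  (t : square g h) (s : square f g) :
  amor h ⋅ (sq0 t ⋅ sq0 s) = sq1 t ⋅ sq1 s ⋅ amor f.
Proof. by rewrite -cmp_assoc sq_comm cmp_assoc sq_comm cmp_assoc. Qed.

Definition ArrowCat (C : Category) : Category.
Proof.
refine (@Build_Category (arrow C) (@square C)
  (fun f => Square (idm _) (idm _) (square_id_comm f))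
  (fun f g h t s => Square (sq0 t ⋅ sq0 s) (sq1 t ⋅ sq1 s)
                           (square_cmp_comm t s)) _ _ _);
  intros; apply: square_eq; rewrite /=.
- exact: cmp_assoc.
- exact: cmp_assoc.
- exact: cmp_idl.
- exact: cmp_idl.
- exact: cmp_idr.
- exact: cmp_idr.
Defined.

Lemma arrow_fmap_comm (C D : Category) (F : Functor C D) (f g : arrow C)
  (s : square f g) :
  fmap F (amor g) ⋅ fmap F (sq0 s) = fmap F (sq1 s) ⋅ fmap F (amor f).
Proof. by rewrite -!fmap_cmp sq_comm. Qed.

Definition arrow_fun (C D : Category) (F : Functor C D) :
  Functor (ArrowCat C) (ArrowCat D).
Proof.
refine (@Build_Functor (ArrowCat C) (ArrowCat D)
  (fun f => Arrow (fmap F (amor f)))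
  (fun f g s => @Square D (Arrow (fmap F (amor f))) (Arrow (fmap F (amor g)))
     (fmap F (sq0 s)) (fmap F (sq1 s)) (arrow_fmap_comm F s)) _ _);
  intros; apply: square_eq; rewrite /=.
- exact: fmap_id.
- exact: fmap_id.
- exact: fmap_cmp.
- exact: fmap_cmp.
Defined.

Definition arrow_nt (C D : Category) (F G : Functor C D) (t : NatTrans F G) :
  NatTrans (arrow_fun F) (arrow_fun G).
Proof.
refine (@Build_NatTrans _ _ (arrow_fun F) (arrow_fun G)
  (fun f => @Square D (Arrow (fmap F (amor f))) (Arrow (fmap G (amor f)))
     (t (asrc f)) (t (atgt f)) (nt_nat t (amor f))) _).
by intros f g s; apply: square_eq; rewrite /= nt_nat.
Defined.

Definition arrow_2fun : TwoFunctor Cat Cat.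
Proof.
refine (@Build_TwoFunctor Cat Cat ArrowCat arrow_fun arrow_nt
  _ _ _ _ _ _); intros.
- by apply: Functor_eq => f g s; apply: square_heq; exact: heq_refl.
- by apply: Functor_eq => f' g' s; apply: square_heq; exact: heq_refl.
- by apply: NatTrans_eq => h; apply: square_eq.
- by apply: NatTrans_eq => k; apply: square_eq.
- apply: NatTrans_heq => [||h];
    [apply: Functor_eq => ???|apply: Functor_eq => ???|];
    apply: square_heq; exact: heq_refl.
- apply: NatTrans_heq => [||h];
    [apply: Functor_eq => ???|apply: Functor_eq => ???|];
    apply: square_heq; exact: heq_refl.
Defined.

Definition src_fun (C : Category) : Functor (ArrowCat C) C :=
  @Build_Functor (ArrowCat C) C (fun f => asrc f) (fun f g s => sq0 s)
    (fun f => eq_refl) (fun f g h t s => eq_refl).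

Definition tgt_fun (C : Category) : Functor (ArrowCat C) C :=
  @Build_Functor (ArrowCat C) C (fun f => atgt f) (fun f g s => sq1 s)
    (fun f => eq_refl) (fun f g h t s => eq_refl).

(* (f, id_b) : f -> id_b  and  (id_a, f) : id_a -> f,  for f : a -> b. *)
Definition to_idm (C : Category) (f : arrow C) :
  square f (Arrow (idm (atgt f))) :=
  @Square C f (Arrow (idm (atgt f))) (amor f) (idm (atgt f)) eq_refl.

Definition of_idm (C : Category) (f : arrow C) :
  square (Arrow (idm (asrc f))) f :=
  @Square C (Arrow (idm (asrc f))) f (idm (asrc f)) (amor f) eq_refl.

Definition deltaA_fun (C : Category) :
  Functor (ArrowCat C) (ArrowCat (ArrowCat C)).
Proof.
unshelve refine (@Build_Functor (ArrowCat C) (ArrowCat (ArrowCat C))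
  (fun f => @Arrow (ArrowCat C) f (Arrow (idm (atgt f))) (to_idm f))
  (fun f g s => @Square (ArrowCat C)
     (@Arrow (ArrowCat C) f (Arrow (idm (atgt f))) (to_idm f))
     (@Arrow (ArrowCat C) g (Arrow (idm (atgt g))) (to_idm g))
     s
     (@Square C (Arrow (idm (atgt f))) (Arrow (idm (atgt g)))
        (sq1 s) (sq1 s) _) _) _ _).
- by rewrite /= cmp_idl cmp_idr.
- by apply: square_eq; rewrite /= ?sq_comm ?cmp_idl ?cmp_idr.
- by move=> f; apply: square_eq => //; apply: square_eq.
- by move=> f g h t s; apply: square_eq => //; apply: square_eq.
Defined.

Definition deltaV_fun (C : Category) :
  Functor (ArrowCat C) (ArrowCat (ArrowCat C)).
Proof.
unshelve refine (@Build_Functor (ArrowCat C) (ArrowCat (ArrowCat C))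
  (fun f => @Arrow (ArrowCat C) (Arrow (idm (asrc f))) f (of_idm f))
  (fun f g s => @Square (ArrowCat C)
     (@Arrow (ArrowCat C) (Arrow (idm (asrc f))) f (of_idm f))
     (@Arrow (ArrowCat C) (Arrow (idm (asrc g))) g (of_idm g))
     (@Square C (Arrow (idm (asrc f))) (Arrow (idm (asrc g)))
        (sq0 s) (sq0 s) _)
     s _) _ _).
- by rewrite /= cmp_idl cmp_idr.
- by apply: square_eq; rewrite /= ?sq_comm ?cmp_idl ?cmp_idr.
- by move=> f; apply: square_eq => //; apply: square_eq.
- by move=> f g h t s; apply: square_eq => //; apply: square_eq.
Defined.

(* Reduces an equality of (iterated) squares to their underlying morphisms. *)
Ltac dsq := cbn;
  first [ exact: heq_refl | apply: square_heq; dsq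
        | by apply: eq_heq; rewrite ?fmap_id | idtac ].

(* Both comonads have the same underlying 2-functor; A has counit the source
   and V has counit the target. *)
Definition comonadA : TwoComonad Cat.
Proof.
refine (@Build_TwoComonad Cat arrow_2fun src_fun deltaA_fun
  _ _ _ _ _ _ _); intros.
- by apply: Functor_eq => f' g' s; exact: heq_refl.
- apply: NatTrans_heq => [||h];
    [apply: Functor_eq => ???|apply: Functor_eq => ???|]; exact: heq_refl.
- by apply: Functor_eq => f' g' s; dsq.
- by apply: NatTrans_heq => [||h];
    [apply: Functor_eq => ???|apply: Functor_eq => ???|]; dsq.
- by apply: Functor_eq => f' g' s; dsq.
- by apply: Functor_eq => f' g' s; dsq.
- by apply: Functor_eq => f' g' s; dsq.
Defined.

Definition comonadV : TwoComonad Cat.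
Proof.
refine (@Build_TwoComonad Cat arrow_2fun tgt_fun deltaV_fun
  _ _ _ _ _ _ _); intros.
- by apply: Functor_eq => f' g' s; exact: heq_refl.
- apply: NatTrans_heq => [||h];
    [apply: Functor_eq => ???|apply: Functor_eq => ???|]; exact: heq_refl.
- by apply: Functor_eq => f' g' s; dsq.
- by apply: NatTrans_heq => [||h];
    [apply: Functor_eq => ???|apply: Functor_eq => ???|]; dsq.
- by apply: Functor_eq => f' g' s; dsq.
- by apply: Functor_eq => f' g' s; dsq.
- by apply: Functor_eq => f' g' s; dsq.
Defined.

(* (h_0, h_1) : f -> g  is sent to  (f, g) : h_0 -> h_1. *)
Definition transpose (C : Category) (f g : arrow C) (S : square f g) :
  square (Arrow (sq0 S)) (Arrow (sq1 S)) :=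
  @Square C (Arrow (sq0 S)) (Arrow (sq1 S)) (amor f) (amor g)
    (eq_sym (sq_comm S)).

Definition transpose_fun (C : Category) :
  Functor (ArrowCat (ArrowCat C)) (ArrowCat (ArrowCat C)).
Proof.
unshelve refine (@Build_Functor
  (ArrowCat (ArrowCat C)) (ArrowCat (ArrowCat C))
  (fun S => @Arrow (ArrowCat C) (Arrow (sq0 (amor S))) (Arrow (sq1 (amor S)))
     (transpose (amor S)))
  (fun S S' t => @Square (ArrowCat C)
     (@Arrow (ArrowCat C) (Arrow (sq0 (amor S))) (Arrow (sq1 (amor S)))
        (transpose (amor S)))
     (@Arrow (ArrowCat C) (Arrow (sq0 (amor S'))) (Arrow (sq1 (amor S')))
        (transpose (amor S')))
     (@Square C (Arrow (sq0 (amor S))) (Arrow (sq0 (amor S')))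
        (sq0 (sq0 t)) (sq0 (sq1 t)) _)
     (@Square C (Arrow (sq1 (amor S))) (Arrow (sq1 (amor S')))
        (sq1 (sq0 t)) (sq1 (sq1 t)) _) _) _ _).
- exact: (f_equal (@sq0 _ _ _) (sq_comm t)).
- exact: (f_equal (@sq1 _ _ _) (sq_comm t)).
- by apply: square_eq; [exact: (sq_comm (sq0 t))|exact: (sq_comm (sq1 t))].
- by move=> S; apply: square_eq; apply: square_eq.
- by move=> S S' S'' t s; apply: square_eq; apply: square_eq.
Defined.

Definition dist_lambda : ComonadDistLaw comonadV comonadA.
Proof.
refine (@Build_ComonadDistLaw Cat comonadV comonadA transpose_fun
  transpose_fun _ _ _ _ _ _ _ _); intros;
  try (by apply: Functor_eq => S S' t; dsq).
apply: NatTrans_heq => [||S];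
  [apply: Functor_eq => ???|apply: Functor_eq => ???|]; dsq.
Defined.

Record PointedCategory := {
  pc_cat :> Category;
  zero : pc_cat;
  from0 : forall a : pc_cat, Hom zero a;
  to0 : forall a : pc_cat, Hom a zero;
  from0_unique : forall (a : pc_cat) (f : Hom zero a), f = from0 a;
  to0_unique : forall (a : pc_cat) (f : Hom a zero), f = to0 a
}.

Arguments zero {p}.
Arguments from0 {p} a.
Arguments to0 {p} a.

Definition zeromor (C : PointedCategory) (a b : C) : Hom a b :=
  from0 b ⋅ to0 a.

Lemma from0_eq (C : PointedCategory) (a : C) (f g : Hom zero a) : f = g.
Proof. by rewrite (from0_unique f) (from0_unique g). Qed.

Lemma to0_eq (C : PointedCategory) (a : C) (f g : Hom a zero) : f = g.
Proof. by rewrite (to0_unique f) (to0_unique g). Qed.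

(* a |-> (!^a : 0 -> a)  and  a |-> (!_a : a -> 0). *)
Definition beta_up (C : PointedCategory) : Functor C (ArrowCat C).
Proof.
unshelve refine (@Build_Functor C (ArrowCat C) (fun a => Arrow (from0 a))
  (fun a b f => @Square C (Arrow (from0 a)) (Arrow (from0 b)) (idm zero) f _)
  _ _).
- exact: from0_eq.
- by move=> a; apply: square_eq.
- by move=> a b c g f; apply: square_eq => //; exact: from0_eq.
Defined.

Definition beta_dn (C : PointedCategory) : Functor C (ArrowCat C).
Proof.
unshelve refine (@Build_Functor C (ArrowCat C) (fun a => Arrow (to0 a))
  (fun a b f => @Square C (Arrow (to0 a)) (Arrow (to0 b)) f (idm zero) _)
  _ _).
- exact: to0_eq.
- by move=> a; apply: square_eq.
- by move=> a b c g f; apply: square_eq => //; exact: to0_eq.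
Defined.

Definition pointed_coalgebra (C : PointedCategory) : CoalgCat dist_lambda.
Proof.
refine (@Build_BiCoalgebra Cat comonadV comonadA dist_lambda (pc_cat C)
  (beta_up C) (beta_dn C) _ _ _ _ _).
- by apply: Functor_eq => a b f; exact: heq_refl.
- apply: Functor_eq => a b f; dsq; apply: eq_heq; exact: from0_eq.
- by apply: Functor_eq => a b f; exact: heq_refl.
- apply: Functor_eq => a b f; dsq; apply: eq_heq; exact: to0_eq.
- apply: Functor_eq => a b f; dsq; apply: eq_heq;
    first [exact: to0_eq|exact: from0_eq].
Defined.

(* The mediating morphism [ker_lift] is data only for convenience: it is
   determined by [ker_lift_unique]. Likewise for [coker_desc]. *)
Record ChosenKernels (C : PointedCategory) := {
  ker : forall (a b : C), Hom a b -> C;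
  kappa : forall (a b : C) (f : Hom a b), Hom (ker f) a;
  kappa_zero : forall (a b : C) (f : Hom a b),
    f ⋅ kappa f = zeromor (ker f) b;
  ker_lift : forall (a b : C) (f : Hom a b) (x : C) (h : Hom x a),
    f ⋅ h = zeromor x b -> Hom x (ker f);
  kappa_lift : forall (a b : C) (f : Hom a b) (x : C) (h : Hom x a)
    (e : f ⋅ h = zeromor x b), kappa f ⋅ ker_lift e = h;
  ker_lift_unique : forall (a b : C) (f : Hom a b) (x : C) (h : Hom x a)
    (e : f ⋅ h = zeromor x b) (u : Hom x (ker f)),
    kappa f ⋅ u = h -> u = ker_lift e;
  kappa_to0 : forall a : C, heq (kappa (to0 a)) (idm a);
  kappa_idm : forall a : C, heq (kappa (idm a)) (from0 a)
}.

Record ChosenCokernels (C : PointedCategory) := {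
  coker : forall (a b : C), Hom a b -> C;
  proj : forall (a b : C) (f : Hom a b), Hom b (coker f);
  proj_zero : forall (a b : C) (f : Hom a b),
    proj f ⋅ f = zeromor a (coker f);
  coker_desc : forall (a b : C) (f : Hom a b) (x : C) (h : Hom b x),
    h ⋅ f = zeromor a x -> Hom (coker f) x;
  desc_proj : forall (a b : C) (f : Hom a b) (x : C) (h : Hom b x)
    (e : h ⋅ f = zeromor a x), coker_desc e ⋅ proj f = h;
  coker_desc_unique : forall (a b : C) (f : Hom a b) (x : C) (h : Hom b x)
    (e : h ⋅ f = zeromor a x) (u : Hom (coker f) x),
    u ⋅ proj f = h -> u = coker_desc e;
  proj_from0 : forall a : C, heq (proj (from0 a)) (idm a);
  proj_idm : forall a : C, heq (proj (idm a)) (to0 a)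
}.

Arguments ker_lift {C} _ {a b f x h} _.
Arguments coker_desc {C} _ {a b f x h} _.

Lemma zeromor_cmp_l (C : PointedCategory) (a b c : C) (h : Hom b c) :
  h ⋅ zeromor a b = zeromor a c.
Proof.
by rewrite /zeromor -cmp_assoc; congr (_ ⋅ _); exact: from0_eq.
Qed.

Lemma zeromor_cmp_r (C : PointedCategory) (a b c : C) (h : Hom a b) :
  zeromor b c ⋅ h = zeromor a c.
Proof. by rewrite /zeromor cmp_assoc; congr (_ ⋅ _); exact: to0_eq. Qed.

Lemma ker_map_zero (C : PointedCategory) (Kr : ChosenKernels C)
  (f g : arrow C) (S : square f g) :
  amor g ⋅ (sq0 S ⋅ kappa Kr (amor f)) =
  zeromor (ker Kr (amor f)) (atgt g).
Proof.
by rewrite -cmp_assoc sq_comm cmp_assoc kappa_zero zeromor_cmp_l.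
Qed.

Definition ker_map (C : PointedCategory) (Kr : ChosenKernels C)
  (f g : arrow C) (S : square f g) :
  Hom (ker Kr (amor f)) (ker Kr (amor g)) :=
  ker_lift Kr (ker_map_zero Kr S).

Lemma coker_map_zero (C : PointedCategory) (Ck : ChosenCokernels C)
  (f g : arrow C) (S : square f g) :
  (proj Ck (amor g) ⋅ sq1 S) ⋅ amor f =
  zeromor (asrc f) (coker Ck (amor g)).
Proof.
by rewrite cmp_assoc -sq_comm -cmp_assoc proj_zero zeromor_cmp_r.
Qed.

Definition coker_map (C : PointedCategory) (Ck : ChosenCokernels C)
  (f g : arrow C) (S : square f g) :
  Hom (coker Ck (amor f)) (coker Ck (amor g)) :=
  coker_desc Ck (coker_map_zero Ck S).

(* (id_a, !_b) : f -> !_a,  for f : a -> b. *)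
Definition square_to0 (C : PointedCategory) (a b : C) (f : Hom a b) :
  square (Arrow f) (Arrow (to0 a)) :=
  @Square C (Arrow f) (Arrow (to0 a)) (idm a) (to0 b) (to0_eq _ _).

(* (!^a, id_b) : !^b -> f,  for f : a -> b. *)
Definition square_from0 (C : PointedCategory) (a b : C) (f : Hom a b) :
  square (Arrow (from0 b)) (Arrow f) :=
  @Square C (Arrow (from0 b)) (Arrow f) (from0 a) (idm b) (from0_eq _ _).

Definition at_square (C D : Category) (F : Functor (ArrowCat C) D)
  (f g : arrow C) (S : square f g) : Hom (F f) (F g) :=
  @fmap (ArrowCat C) D F f g S.

Definition colax_fun (C : PointedCategory)
  (A1 : ColaxAlgebra (T1 dist_lambda) (pointed_coalgebra C)) :
  Functor (ArrowCat C) C := cm1 (colax_map A1).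

Definition lax_fun (C : PointedCategory)
  (A2 : LaxAlgebra (T2 dist_lambda) (pointed_coalgebra C)) :
  Functor (ArrowCat C) C := cm1 (lax_map A2).

(* α_2(f) = ker f, κ_f = α_2(id_a, !_b), and α_2(S) is the induced map; dually
   for cokernels. The types of the two sides agree only propositionally
   (κ_f uses α_2(!_a) = a), hence [heq]. *)
Record kernels_match (C : PointedCategory) (Kr : ChosenKernels C)
    (A2 : LaxAlgebra (T2 dist_lambda) (pointed_coalgebra C)) : Prop := {
  match_ker : forall (a b : C) (f : Hom a b),
    lax_fun A2 (Arrow f) = ker Kr f;
  match_kappa : forall (a b : C) (f : Hom a b),
    heq (at_square (lax_fun A2) (square_to0 f)) (kappa Kr f);
  match_ker_map : forall (f g : arrow C) (S : square f g),
    heq (at_square (lax_fun A2) S) (ker_map Kr S)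
}.

Record cokernels_match (C : PointedCategory) (Ck : ChosenCokernels C)
    (A1 : ColaxAlgebra (T1 dist_lambda) (pointed_coalgebra C)) : Prop := {
  match_coker : forall (a b : C) (f : Hom a b),
    colax_fun A1 (Arrow f) = coker Ck f;
  match_proj : forall (a b : C) (f : Hom a b),
    heq (at_square (colax_fun A1) (square_from0 f)) (proj Ck f);
  match_coker_map : forall (f g : arrow C) (S : square f g),
    heq (at_square (colax_fun A1) (transpose S)) (coker_map Ck (transpose S))
}.

Definition MixedCell (C : PointedCategory)
  (A1 : ColaxAlgebra (T1 dist_lambda) (pointed_coalgebra C))
  (A2 : LaxAlgebra (T2 dist_lambda) (pointed_coalgebra C)) : Type :=
  cell2 (colax_map A1 ∘ tf1 (T1 dist_lambda) (lax_map A2))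
        (lax_map A2 ∘ tf1 (T2 dist_lambda) (colax_map A1)
           ∘ mlam (coalg_dist dist_lambda) (pointed_coalgebra C)).

(* The component of ψ at S : f -> g, seen as an object of V A C; it goes from
   α_1(α_2(S)) to α_2(α_1(λ(S))). *)
Definition mixed_component (C : PointedCategory)
  (A1 : ColaxAlgebra (T1 dist_lambda) (pointed_coalgebra C))
  (A2 : LaxAlgebra (T2 dist_lambda) (pointed_coalgebra C))
  (psi : MixedCell A1 A2) (f g : arrow C) (S : square f g) :
  Hom (colax_fun A1 (Arrow (at_square (lax_fun A2) S)))
      (lax_fun A2 (Arrow (at_square (colax_fun A1) (transpose S)))) :=
  ntc (cm2 psi) (@Arrow (ArrowCat C) f g S).

(* Main.v *)
From Stdlib Require Import ssreflect ProofIrrelevance FunctionalExtensionality.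
Require Import Defs.

(** A normalized lax algebra carries no more information than its functor
    [α : A C -> C], and [α] is a choice of kernels.

    Write [κ_f = α(id_a, !_b)] for [f : a -> b]. Since [(f, id_0)] precomposed
    with [(id_a, !_b)] factors through [id_b], and being a coalgebra map forces
    [α(id_b) = 0], one gets [f κ_f = 0]. A morphism [h] with [f h = 0] is the
    same as a square [(h, 0) : !_x -> f], and [α] of that square is a lift of
    [h] along [κ_f]. Uniqueness of lifts is where the 2-cell [φ] enters. For a
    square [S = (h_0, h_1) : f -> g], the squares [(id, !)] assemble into a cube
    from [S] to [(h_0, id_0)]. The 2-cell is the identity at [(h_0, id_0)], by
    the first unit axiom, so naturality at that cube gives
    [φ_S = α(κ_f, κ_g)] ([lax_cellE]). At [S = (f, id_b) : f -> id_b] the other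
    unit axiom makes the left-hand side an identity, so the lift of [κ_f] along
    itself is the identity ([lax_lift_kappa]); as lifting commutes with
    precomposition, lifts are unique. The formula for [φ_S] also shows that [α]
    determines [φ], hence that an algebra matching given kernels is unique.

    Conversely, given kernels, take [α = ker] and let [φ_S] be the morphism with
    [κ_{h_0} φ_S = κ_f κ_{ker S}]. Every axiom becomes an equation between
    morphisms into a kernel, checked after composing with the monomorphism [κ].
    Compatibility of a 2-cell with the coalgebra structures is automatic when
    its codomain is the pointed category ([pointed_cell]). Everything about
    colax algebras and cokernels is dual.

    As the two matching results identify algebras with choices of (co)kernels,
    the rewriting rule has to be studied only for the algebras built from such
    choices. There [ψ_S] is obtained by lifting [π_{h_0} κ_g] to a kernel and
    descending it to a cokernel, and an equation between morphisms from a
    cokernel to a kernel may be tested between [π] and [κ]. In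
    [mixed_rule_a] both sides then become [π κ κ], in [mixed_rule_b] [π π κ].
    Conversely, [mixed_rule_c] fixes [ψ] at the squares [0 -> g], and naturality
    along the evident map from [0 -> g] to [S] gives [κ ψ_S π = π_{h_0} κ_g], so
    [ψ] is unique ([mixed_cell_unique]).

    Equations such as [α(!_a) = a] hold only propositionally, so most
    statements use the heterogeneous equality [heq]; the lemmas
    [kappa_heq_mono] and [proj_heq_epi] are the form in which [κ] is cancelled
    on the left and [π] on the right in that setting. *)

Set Implicit Arguments.
Unset Strict Implicit.
Unset Printing Implicit Defensive.

(** * Heterogeneous equality of morphisms *)

Lemma heq_cmp (C : Category) (a b c a' b' c' : C) (g : Hom b c) (f : Hom a b)
  (g' : Hom b' c') (f' : Hom a' b') :
  heq g g' -> heq f f' -> heq (g ⋅ f) (g' ⋅ f').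
Proof.
move=> hg hf; have eb := heq_src hg; have ec := heq_tgt hg; have ea := heq_src hf.
subst a' b' c'; rewrite (heq_eq hg) (heq_eq hf); exact: heq_refl.
Qed.

Lemma heq_fmap (C D : Category) (F : Functor C D) (a b a' b' : C)
  (f : Hom a b) (f' : Hom a' b') : heq f f' -> heq (fmap F f) (fmap F f').
Proof. by move=> h; destruct h; exact: heq_refl. Qed.

(** How an equality of functors, such as a unit law of an algebra, is used on
    morphisms. *)
Lemma Functor_eq_fmap (C D : Category) (F G : Functor C D) (a b : C)
  (f : Hom a b) : F = G -> heq (fmap F f) (fmap G f).
Proof. by move=> ->; exact: heq_refl. Qed.

Lemma heq_idm (C : Category) (a b : C) : a = b -> heq (idm a) (idm b).
Proof. by move=> ->; exact: heq_refl. Qed.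

Lemma heq_Arrow (C : Category) (f g : arrow C) : f = g -> heq (amor f) (amor g).
Proof. by move=> ->; exact: heq_refl. Qed.

Lemma heq_to0 (C : PointedCategory) (a b a' b' : C) (f : Hom a b)
  (f' : Hom a' b') : a = a' -> b = zero -> b' = zero -> heq f f'.
Proof.
by move=> ea eb eb'; subst a' b b'; apply: eq_heq; exact: to0_eq.
Qed.

Lemma heq_from0 (C : PointedCategory) (a b a' b' : C) (f : Hom a b)
  (f' : Hom a' b') : b = b' -> a = zero -> a' = zero -> heq f f'.
Proof.
by move=> ea eb eb'; subst a a' b'; apply: eq_heq; exact: from0_eq.
Qed.

Lemma cmp_through0 (C : PointedCategory) (a m b : C) (g : Hom m b)
  (f : Hom a m) : m = zero -> g ⋅ f = zeromor a b.
Proof.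
by move=> em; subst m; rewrite /zeromor (from0_unique g) (to0_unique f).
Qed.

Lemma heq_zeromor (C : PointedCategory) (a b a' b' : C) :
  a = a' -> b = b' -> heq (zeromor a b) (zeromor a' b').
Proof. by move=> -> ->; exact: heq_refl. Qed.

Definition cast_hom (C : Category) (a b a' b' : C) (ea : a = a') (eb : b = b')
  (f : Hom a b) : Hom a' b' :=
  eq_rect b (Hom a') (eq_rect a (fun x => Hom x b) f a' ea) b' eb.

Lemma heq_cast (C : Category) (a b a' b' : C) (ea : a = a') (eb : b = b')
  (f : Hom a b) : heq (cast_hom ea eb f) f.
Proof. by destruct ea, eb; exact: heq_refl. Qed.

Lemma heq_square (C : Category) (f g f' g' : arrow C)
  (s : square f g) (t : square f' g') :
  f = f' -> g = g' -> heq (sq0 s) (sq0 t) -> heq (sq1 s) (sq1 t) -> heq s t.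
Proof. by move=> /heq_Arrow ? /heq_Arrow ? *; exact: square_heq. Qed.

Lemma cmp_reassoc (C : Category) (a b c : C) (g : Hom b c) (f : Hom a b)
  (h : Hom a c) :
  g ⋅ f = h -> forall (z : C) (k : Hom z a), g ⋅ (f ⋅ k) = h ⋅ k.
Proof. by move=> <- z k; rewrite cmp_assoc. Qed.

Lemma cmp_reassoc3 (C : Category) (a b c d : C) (g : Hom c d) (f : Hom b c)
  (e : Hom a b) (h : Hom a d) : g ⋅ f ⋅ e = h ->
  forall (z : C) (k : Hom z a), g ⋅ (f ⋅ (e ⋅ k)) = h ⋅ k.
Proof. by move=> <- z k; rewrite !cmp_assoc. Qed.

Lemma transposeK (C : Category) (f g : arrow C) (S : square f g) :
  transpose (transpose S) = S.
Proof. exact: square_eq. Qed.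

(** The two sides differ only in their proofs of commutativity, but those
    proofs occur in the objects [coker_map] and [ker_map] produce, so the
    boundaries of the rule axioms agree only through this equation. *)
Lemma transpose_fmap (C' D : Category) (F : Functor C' D) (f g : arrow C')
  (S : square f g) :
  transpose (fmap (arrow_fun F) S) = fmap (arrow_fun F) (transpose S).
Proof. exact: square_eq. Qed.

(** * 2-cells into a pointed category *)

(** Equality of 2-cells of coalgebras, reduced to components. The boundary
    equations are left as equations of 1-cells, where the 2-categorical axioms
    prove them. *)
Lemma coalg_cell_heq (X Y : CoalgCat dist_lambda) (f g f' g' : cell1 X Y)
  (s : cell2 f g) (t : cell2 f' g') : f = f' -> g = g' ->
  (forall x, heq (ntc (cm2 s) x) (ntc (cm2 t) x)) -> heq s t.
Proof.
by move=> ef eg h; subst f' g'; apply: CoalgCell_heq; apply: NatTrans_heq.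
Qed.

(** [v] and [u] need only be heterogeneously equal to the components: this
    absorbs the transport hidden in [□[e]], and lets the caller choose
    representatives that compose on the nose. *)
Lemma vcomp_along_ntc (X Y : CoalgCat dist_lambda) (f g g' h : cell1 X Y)
  (s : cell2 g' h) (e : g = g') (t : cell2 f g) (x : Ob (bc_car X))
  (a b c : Ob (bc_car Y)) (v : Hom b c) (u : Hom a b) :
  heq (ntc (cm2 s) x) v -> heq (ntc (cm2 t) x) u ->
  heq (ntc (cm2 (s □[e] t)) x) (v ⋅ u).
Proof. by subst g' => hv hu; apply: heq_cmp. Qed.

Section PointedCells.
Variables (C : PointedCategory) (Y : CoalgCat dist_lambda).
Variables (F G : CoalgMap Y (pointed_coalgebra C)).
Variable t : NatTrans (cm1 F) (cm1 G).

Lemma heq_ntc (x y : Ob (bc_car Y)) : x = y -> heq (ntc t x) (ntc t y).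
Proof. by move=> ->; exact: heq_refl. Qed.

Lemma coalg_map_src (H : CoalgMap Y (pointed_coalgebra C)) (y : Ob (bc_car Y)) :
  cm1 H (asrc (bup Y y)) = zero.
Proof.
exact: (f_equal (fun K : Functor (bc_car Y) (ArrowCat C) => asrc (K y))
  (cm1_up H)).
Qed.

Lemma coalg_map_tgt (H : CoalgMap Y (pointed_coalgebra C)) (y : Ob (bc_car Y)) :
  cm1 H (atgt (bdn Y y)) = zero.
Proof.
exact: (f_equal (fun K : Functor (bc_car Y) (ArrowCat C) => atgt (K y))
  (cm1_dn H)).
Qed.

Lemma bup_tgt (y : Ob (bc_car Y)) : atgt (bup Y y) = y.
Proof.
exact: (f_equal (fun K : Functor (bc_car Y) (bc_car Y) => K y) (bup_eps Y)).
Qed.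

Lemma bdn_src (y : Ob (bc_car Y)) : asrc (bdn Y y) = y.
Proof.
exact: (f_equal (fun K : Functor (bc_car Y) (bc_car Y) => K y) (bdn_eps Y)).
Qed.

(** The components of both compatibility conditions are squares having [t]
    itself as one leg, while the other leg starts and ends at zero objects;
    hence they hold for every natural transformation. *)
Definition pointed_cell : CoalgCell F G.
Proof.
exists t.
- apply: NatTrans_heq => [||y]; [exact: (cm1_up F)|exact: (cm1_up G)|].
  apply: heq_square => /=.
  + apply: (f_equal (fun K : Functor (bc_car Y) (ArrowCat C) => K y) (cm1_up F)).
  + apply: (f_equal (fun K : Functor (bc_car Y) (ArrowCat C) => K y) (cm1_up G)).
  + by apply: heq_to0 => //; exact: coalg_map_src.
  + by apply: heq_ntc; exact: bup_tgt.
- apply: NatTrans_heq => [||y]; [exact: (cm1_dn F)|exact: (cm1_dn G)|].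
  apply: heq_square => /=.
  + apply: (f_equal (fun K : Functor (bc_car Y) (ArrowCat C) => K y) (cm1_dn F)).
  + apply: (f_equal (fun K : Functor (bc_car Y) (ArrowCat C) => K y) (cm1_dn G)).
  + by apply: heq_ntc; exact: bdn_src.
  + by apply: heq_to0 => //; exact: coalg_map_tgt.
Defined.
End PointedCells.

(** * Kernels from a lax algebra *)

Section LaxToKernels.
Variables (C : PointedCategory) (A : LaxAlgebra (T2 dist_lambda) (pointed_coalgebra C)).

Let al := lax_fun A.

Lemma lax_unit : fun_comp al (beta_dn C) = fun_id C.
Proof. exact: (f_equal (@cm1 _ _ _ _ _ _) (lax_map_eta A)). Qed.

Lemma lax_to0 (a : C) : al (Arrow (to0 a)) = a.
Proof. exact: (f_equal (fun F : Functor C C => F a) lax_unit). Qed.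

Lemma lax_fmap_dn (a b : C) (f : Hom a b) :
  heq (fmap al (fmap (beta_dn C) f)) f.
Proof. exact: (Functor_eq_fmap f lax_unit). Qed.

(** The A-coalgebra condition on [α] identifies the morphism
    [α(f, id_b) : α f -> α(id_b)] with [α f -> 0]; compare codomains. *)
Lemma lax_idm (b : C) : al (Arrow (idm b)) = zero.
Proof.
have h := cm1_dn (lax_map A).
have := f_equal (fun F : Functor (ArrowCat C) (ArrowCat C) =>
  fob F (Arrow (idm b))) h.
move=> /(f_equal (fun f : arrow C => atgt f)); exact.
Qed.

Definition lax_kappa (f : arrow C) : Hom (al f) (asrc f) :=
  cast_hom eq_refl (lax_to0 (asrc f)) (at_square al (square_to0 (amor f))).

Lemma heq_lax_kappa (f : arrow C) :
  heq (lax_kappa f) (at_square al (square_to0 (amor f))).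
Proof. exact: heq_cast. Qed.

Lemma lax_kappa_zero (f : arrow C) :
  amor f ⋅ lax_kappa f = zeromor (al f) (atgt f).
Proof.
apply: heq_eq.
apply: heq_trans.
  apply: heq_cmp; first by apply: heq_sym; exact: lax_fmap_dn.
  exact: heq_lax_kappa.
rewrite -fmap_cmp.
have -> : fmap (beta_dn C) (amor f) ⋅ square_to0 (amor f) =
  @cmp (ArrowCat C) _ _ _ (square_to0 (idm (atgt f))) (to_idm f).
  apply: square_eq => /=; first by rewrite cmp_idl cmp_idr.
  exact: to0_eq.
rewrite fmap_cmp cmp_through0; first exact: lax_idm.
by apply: heq_zeromor => //; exact: lax_to0.
Qed.

(** [f h = 0] is exactly the commutativity of the square
    [(h, 0) : (x -> 0) -> f], because [zeromor] is by definition the composite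
    through [0]. *)
Definition lax_lift (f : arrow C) (x : C) (h : Hom x (asrc f))
  (e : amor f ⋅ h = zeromor x (atgt f)) : Hom x (al f) :=
  cast_hom (lax_to0 x) eq_refl
    (at_square al (@Square C (Arrow (to0 x)) f h (from0 (atgt f)) e)).

Lemma lax_kappa_lift (f : arrow C) (x : C) (h : Hom x (asrc f))
  (e : amor f ⋅ h = zeromor x (atgt f)) : lax_kappa f ⋅ lax_lift e = h.
Proof.
apply: heq_eq.
apply: heq_trans; first by apply: heq_cmp; [exact: heq_lax_kappa|exact: heq_cast].
rewrite /at_square -fmap_cmp.
apply: heq_trans; last exact: lax_fmap_dn.
rewrite [X in fmap al X](_ : _ = fmap (beta_dn C) h); last exact: heq_refl.
apply: square_eq => /=; first by rewrite cmp_idl.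
exact: to0_eq.
Qed.

Lemma lax_lift_cmp (f : arrow C) (x y : C) (h : Hom x (asrc f)) (u : Hom y x)
  (e : amor f ⋅ h = zeromor x (atgt f))
  (e' : amor f ⋅ (h ⋅ u) = zeromor y (atgt f)) :
  lax_lift e' = lax_lift e ⋅ u.
Proof.
apply: heq_eq.
apply: heq_trans; first exact: heq_cast.
apply: heq_trans; last first.
  by apply: heq_cmp; [apply: heq_sym; exact: heq_cast|exact: lax_fmap_dn].
rewrite /at_square -fmap_cmp; apply: eq_heq; congr fmap.
by apply: square_eq => //=; rewrite cmp_idr.
Qed.

Lemma lax_cell_unit (a b : C) (f : Hom a b) :
  heq (ntc (cm2 (lax_cell A)) (@Arrow (ArrowCat C) _ _ (fmap (beta_dn C) f)))
      (idm (al (Arrow f))).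
Proof.
exact: (NatTrans_heqP (CoalgCell_heqP (lax_cell_tfeta A)) (Arrow f)).
Qed.

Lemma lax_cell_to_idm (f : arrow C) :
  heq (ntc (cm2 (lax_cell A)) (@Arrow (ArrowCat C) _ _ (to_idm f)))
      (idm (al f)).
Proof.
exact: (NatTrans_heqP (CoalgCell_heqP (lax_cell_eta A)) f).
Qed.

(** The components of the unit square of [S] towards [(h_0, id_0)]; applying
    [A α] to it yields the square [(κ_f, κ_g)]. *)
Definition kappa_cube (f g : arrow C) (S : square f g) :
  @square (ArrowCat C) (@Arrow (ArrowCat C) f g S)
    (@Arrow (ArrowCat C) _ _ (fmap (beta_dn C) (sq0 S))).
Proof.
apply: (@Square (ArrowCat C) (@Arrow (ArrowCat C) f g S)
    (@Arrow (ArrowCat C) _ _ (fmap (beta_dn C) (sq0 S)))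
    (square_to0 (amor f)) (square_to0 (amor g))).
apply: square_eq => /=; first by rewrite cmp_idl cmp_idr.
exact: to0_eq.
Defined.

(** Naturality of [φ] at [kappa_cube S]: the other two sides are identities,
    as [μ] sends the cube to [(id, id)] and the unit axiom applies at its
    codomain. So [φ] is determined by [α]. *)
Lemma lax_cellE (f g : arrow C) (S : square f g) :
  heq (ntc (cm2 (lax_cell A)) (@Arrow (ArrowCat C) f g S))
      (at_square al (fmap (arrow_fun al) (kappa_cube S))).
Proof.
have h : fmap (fun_comp al (arrow_fun (src_fun C))) (kappa_cube S) ⋅ _ =
    _ ⋅ fmap (fun_comp al (arrow_fun al)) (kappa_cube S) :=
  nt_nat (cm2 (lax_cell A)) (kappa_cube S).
have hid : fmap (fun_comp al (arrow_fun (src_fun C))) (kappa_cube S) =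
    idm (al (Arrow (sq0 S))).
  by rewrite -fmap_id /=; congr fmap; exact: square_eq.
move: h; rewrite hid cmp_idl => ->.
apply: heq_trans; last exact: eq_heq (cmp_idl _).
apply: heq_cmp; last exact: heq_refl.
apply: heq_trans; first exact: lax_cell_unit.
apply: heq_idm; symmetry.
exact: (heq_src (lax_cell_unit (sq0 S))).
Qed.

(** The only place where [φ] is needed to make [κ] a kernel: both unit axioms
    apply at [(f, id_b) : f -> id_b], giving [id = φ = α(κ_f, 0)]. *)
Lemma lax_lift_kappa (f : arrow C) :
  lax_lift (lax_kappa_zero f) = idm (al f).
Proof.
apply: heq_eq; apply: heq_trans; first exact: heq_cast.
apply: heq_trans; last exact: lax_cell_to_idm.
apply: heq_trans; last by apply: heq_sym; exact: lax_cellE.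
apply: heq_fmap; apply: heq_square => /=.
- apply: arrow_eq; apply: heq_to0 => //; exact: lax_idm.
- apply: arrow_eq; apply: heq_sym; exact: lax_fmap_dn.
- exact: heq_lax_kappa.
- apply: heq_from0 => //; last exact: lax_idm.
  by symmetry; exact: lax_to0.
Qed.

Lemma lax_lift_unique (f : arrow C) (x : C) (h : Hom x (asrc f))
  (e : amor f ⋅ h = zeromor x (atgt f)) (u : Hom x (al f)) :
  lax_kappa f ⋅ u = h -> u = lax_lift e.
Proof.
move=> eu; subst h.
by rewrite (lax_lift_cmp (lax_kappa_zero f)) lax_lift_kappa cmp_idl.
Qed.

Definition lax_kernels : ChosenKernels C.
Proof.
refine (@Build_ChosenKernels C (fun a b f => al (Arrow f))
  (fun a b f => lax_kappa (Arrow f)) (fun a b f => lax_kappa_zero (Arrow f))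
  (fun a b f x h e => @lax_lift (Arrow f) x h e)
  (fun a b f x h e => @lax_kappa_lift (Arrow f) x h e)
  (fun a b f x h e u => @lax_lift_unique (Arrow f) x h e u) _ _).
- move=> a; apply: heq_trans; first exact: heq_lax_kappa.
  apply: heq_trans; last exact: (lax_fmap_dn (idm a)).
  by apply: eq_heq; congr fmap; apply: square_eq => //; exact: to0_eq.
- move=> a; apply: heq_from0 => //; exact: lax_idm.
Defined.

Lemma lax_kernels_match : kernels_match lax_kernels A.
Proof.
split=> // [a b f|f g S]; first by apply: heq_sym; exact: heq_lax_kappa.
apply: eq_heq.
apply: (@ker_lift_unique C lax_kernels _ _ _ _ _ (ker_map_zero lax_kernels S)
          (at_square al S)).
apply: heq_eq => /=.
apply: heq_trans; first by apply: heq_cmp; [exact: heq_lax_kappa|exact: heq_refl].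
apply: heq_trans; last first.
  by apply: heq_cmp; [exact: lax_fmap_dn|apply: heq_sym; exact: heq_lax_kappa].
rewrite /at_square -!fmap_cmp; apply: eq_heq; congr fmap.
apply: square_eq => /=; first by rewrite cmp_idl cmp_idr.
exact: to0_eq.
Qed.

End LaxToKernels.

(** Kernel objects are the sources of the [κ], lifts are determined by them, and
    the rest is propositional. *)
Lemma ChosenKernels_eq (C : PointedCategory) (K K' : ChosenKernels C) :
  (forall (a b : C) (f : Hom a b), heq (kappa K f) (kappa K' f)) -> K = K'.
Proof.
destruct K as [k ka z l ml u n1 n2]; destruct K' as [k' ka' z' l' ml' u' n1' n2'] => /= h.
have e : k = k'.
  by do 3 (apply: functional_extensionality_dep => ?); exact: heq_src (h _ _ _).
subst k'.
have e : ka = ka'.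
  by do 3 (apply: functional_extensionality_dep => ?); exact: heq_eq (h _ _ _).
subst ka'; rewrite (proof_irrelevance _ z' z).
have e : l = l'.
  by do 6 (apply: functional_extensionality_dep => ?); exact: u'.
subst l'; f_equal; exact: proof_irrelevance.
Qed.

Lemma kernels_match_unique (C : PointedCategory)
  (A : LaxAlgebra (T2 dist_lambda) (pointed_coalgebra C))
  (K K' : ChosenKernels C) :
  kernels_match K A -> kernels_match K' A -> K = K'.
Proof.
move=> m m'; apply: ChosenKernels_eq => a b f.
exact: heq_trans (heq_sym (match_kappa m f)) (match_kappa m' f).
Qed.

(** By [lax_cellE] the 2-cell is an expression in the underlying functor. *)
Lemma LaxAlgebra_eq (C : PointedCategory)
  (A A' : LaxAlgebra (T2 dist_lambda) (pointed_coalgebra C)) :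
  lax_fun A = lax_fun A' -> A = A'.
Proof.
have := @lax_cellE C A; have := @lax_cellE C A'.
destruct A as [m c e1 e2 e3 e4]; destruct A' as [m' c' e1' e2' e3' e4'].
rewrite /lax_fun /= => h' h /(@CoalgMap_eq _ _ _ _ _ _ m m') em; subst m'.
have ec : c = c'.
  apply: CoalgCell_eq; apply: NatTrans_eq => [[f g S]]; apply: heq_eq.
  exact: heq_trans (h _ _ _) (heq_sym (h' _ _ _)).
by subst c'; f_equal; exact: proof_irrelevance.
Qed.

Lemma lax_algebra_match_unique (C : PointedCategory) (K : ChosenKernels C)
  (A A' : LaxAlgebra (T2 dist_lambda) (pointed_coalgebra C)) :
  kernels_match K A -> kernels_match K A' -> A = A'.
Proof.
move=> m m'; apply: LaxAlgebra_eq; apply: Functor_eq => f g S.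
exact: heq_trans (match_ker_map m S) (heq_sym (match_ker_map m' S)).
Qed.

(** * Lax algebras from kernels *)

Section KernelsToLax.
Variables (C : PointedCategory) (Kr : ChosenKernels C).

Lemma kappa_mono (a b : C) (f : Hom a b) (x : C) (u v : Hom x (ker Kr f)) :
  kappa Kr f ⋅ u = kappa Kr f ⋅ v -> u = v.
Proof.
move=> e.
have hv : f ⋅ (kappa Kr f ⋅ v) = zeromor x b.
  by rewrite -cmp_assoc kappa_zero zeromor_cmp_r.
by rewrite (ker_lift_unique hv e); symmetry; exact: ker_lift_unique.
Qed.

Lemma heq_kappa (a b a' b' : C) (f : Hom a b) (f' : Hom a' b') :
  heq f f' -> heq (kappa Kr f) (kappa Kr f').
Proof. by move=> h; destruct h; exact: heq_refl. Qed.

(** Cancellation of [κ] when the two kernels are kernels of propositionally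
    equal morphisms. *)
Lemma kappa_heq_mono (a b a' b' x x' : C) (f : Hom a b) (f' : Hom a' b')
  (u : Hom x (ker Kr f)) (u' : Hom x' (ker Kr f')) : heq f f' ->
  heq (kappa Kr f ⋅ u) (kappa Kr f' ⋅ u') -> heq u u'.
Proof.
move=> h hu; destruct h; have ex := heq_src hu; subst x'.
by apply: eq_heq; apply: kappa_mono; exact: heq_eq.
Qed.

Lemma kappa_ker_map (a b c d : C) (f : Hom a b) (g : Hom c d)
  (S : square (Arrow f) (Arrow g)) :
  kappa Kr g ⋅ ker_map Kr S = sq0 S ⋅ kappa Kr f.
Proof. exact: kappa_lift. Qed.

Definition ker_fun : Functor (ArrowCat C) C.
Proof.
refine (@Build_Functor (ArrowCat C) C (fun f => ker Kr (amor f))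
  (fun f g S => ker_map Kr S) _ _).
- by move=> f; apply: kappa_mono; rewrite kappa_ker_map cmp_idl cmp_idr.
- move=> f g h T S; apply: kappa_mono.
  by rewrite kappa_ker_map -cmp_assoc kappa_ker_map !cmp_assoc kappa_ker_map.
Defined.

Lemma ker_idm (a : C) : ker Kr (idm a) = zero.
Proof. exact: heq_src (kappa_idm Kr a). Qed.

Lemma kappa_heq_to0 (a b : C) (f : Hom a b) : b = zero -> heq (kappa Kr f) (idm a).
Proof.
by move=> eb; subst b; rewrite (to0_unique f); exact: kappa_to0.
Qed.

(** When the codomain of [p] is zero its kernel inclusion is an identity, so it
    can be inserted on the left for free. This covers the unit law, the match
    with [κ], and the boundary cases of the rewriting rule. *)
Lemma ker_map_to0 (a b c d : C) (f : Hom a b) (p : Hom c d)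
  (S : square (Arrow f) (Arrow p)) :
  d = zero -> heq (ker_map Kr S) (sq0 S ⋅ kappa Kr f).
Proof.
move=> ed; apply: heq_trans; last exact: eq_heq (kappa_ker_map S).
apply: heq_trans; first by apply: heq_sym; apply: eq_heq; exact: cmp_idl.
have hp : heq (kappa Kr p) (idm c) by exact: kappa_heq_to0.
apply: heq_cmp; last exact: heq_refl.
apply: heq_trans; last by apply: heq_sym; exact: hp.
by apply: heq_idm; exact: heq_src hp.
Qed.

Lemma ker_map_dn (a b : C) (f : Hom a b) :
  heq (ker_map Kr (fmap (beta_dn C) f)) f.
Proof.
apply: heq_trans; first by apply: ker_map_to0.
apply: heq_trans; last exact: eq_heq (cmp_idr _).
by apply: heq_cmp; [exact: heq_refl|exact: kappa_to0].
Qed.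

Definition ker_coalg_map :
  cell1 (T2 dist_lambda (pointed_coalgebra C)) (pointed_coalgebra C).
Proof.
refine (@Build_CoalgMap _ _ _ dist_lambda (T2_ob (pointed_coalgebra C))
  (pointed_coalgebra C) ker_fun _ _);
  apply: Functor_eq => f g S; apply: heq_square => /=.
- by apply: arrow_eq; apply: heq_from0 => //; exact: ker_idm.
- by apply: arrow_eq; apply: heq_from0 => //; exact: ker_idm.
- by apply: heq_from0 => //; exact: ker_idm.
- by apply: eq_heq; congr ker_map; exact: square_eq.
- by apply: arrow_eq; apply: heq_to0 => //; exact: ker_idm.
- by apply: arrow_eq; apply: heq_to0 => //; exact: ker_idm.
- exact: heq_refl.
- by apply: heq_to0 => //; exact: ker_idm.
Defined.

Lemma ker_cell_zero (f g : arrow C) (S : square f g) :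
  sq0 S ⋅ (kappa Kr (amor f) ⋅ kappa Kr (ker_map Kr S)) =
  zeromor (ker Kr (ker_map Kr S)) (asrc g).
Proof.
by rewrite -cmp_assoc -kappa_ker_map cmp_assoc kappa_zero zeromor_cmp_l.
Qed.

Definition ker_cell_map (f g : arrow C) (S : square f g) :
  Hom (ker Kr (ker_map Kr S)) (ker Kr (sq0 S)) :=
  ker_lift Kr (ker_cell_zero S).

Lemma kappa_ker_cell_map (f g : arrow C) (S : square f g) :
  kappa Kr (sq0 S) ⋅ ker_cell_map S =
  kappa Kr (amor f) ⋅ kappa Kr (ker_map Kr S).
Proof. exact: kappa_lift. Qed.

Definition ker_cell_nt : NatTrans (fun_comp ker_fun (arrow_fun ker_fun))
  (fun_comp ker_fun (arrow_fun (src_fun C))).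
Proof.
exists (fun S : arrow (ArrowCat C) =>
  @ker_cell_map (asrc S) (atgt S) (amor S)) => S S' Q.
apply: kappa_mono.
rewrite -!cmp_assoc /=. 
rewrite kappa_ker_cell_map (@kappa_ker_map _ _ _ _ (sq0 (amor S))) /=.
rewrite [LHS]cmp_assoc kappa_ker_cell_map -[LHS]cmp_assoc.
rewrite [RHS]cmp_assoc (@kappa_ker_map _ _ _ _ (ker_map Kr (amor S))) /=.
by rewrite -[RHS]cmp_assoc (@kappa_ker_map _ _ _ _ (amor (asrc S))).
Defined.

Definition ker_cell : cell2
  (ker_coalg_map ∘ tf1 (T2 dist_lambda) ker_coalg_map)
  (ker_coalg_map ∘ mu (T2 dist_lambda) (pointed_coalgebra C)).
Proof.
exact: (@pointed_cell C (T2 dist_lambda (T2 dist_lambda (pointed_coalgebra C)))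
  (ker_coalg_map ∘ tf1 (T2 dist_lambda) ker_coalg_map)
  (ker_coalg_map ∘ mu (T2 dist_lambda) (pointed_coalgebra C)) ker_cell_nt).
Defined.

(** After composing with [κ], both sides become the same composite of three
    kernel inclusions. *)
Lemma ker_cell_assoc (S S' : arrow (ArrowCat C)) (q : square S S') :
  ker_cell_map (sq0 q) ⋅ ker_cell_map (fmap (arrow_fun ker_fun) q) =
  ker_cell_map (fmap (arrow_fun (src_fun C)) q)
    ⋅ ker_map Kr (ntc (arrow_nt ker_cell_nt) (@Arrow (ArrowCat (ArrowCat C)) S S' q)).
Proof.
apply: kappa_mono; rewrite -[LHS]cmp_assoc kappa_ker_cell_map.
rewrite [LHS]cmp_assoc (kappa_ker_cell_map (fmap (arrow_fun ker_fun) q)).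
rewrite -[RHS]cmp_assoc (kappa_ker_cell_map (fmap (arrow_fun (src_fun C)) q)).
rewrite [RHS]cmp_assoc.
rewrite (@kappa_ker_map _ _ _ _ (ker_map Kr (fmap (arrow_fun ker_fun) q))).
by rewrite -[RHS]cmp_assoc (kappa_ker_cell_map (amor S)) cmp_assoc.
Qed.

Lemma ker_unit :
  ker_coalg_map ∘ eta (T2 dist_lambda) (pointed_coalgebra C) =
  id1 (pointed_coalgebra C).
Proof.
apply: CoalgMap_eq; apply: Functor_eq => a b f; exact: ker_map_dn.
Qed.

Definition ker_lax_algebra : LaxAlgebra (T2 dist_lambda) (pointed_coalgebra C).
Proof.
refine (@Build_LaxAlgebra _ _ _ ker_coalg_map ker_cell ker_unit _ _ _).
- apply: coalg_cell_heq.
  + by rewrite comp1_assoc -tf1_comp ker_unit tf1_id comp1_idr.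
  + by rewrite comp1_assoc mu_tfeta comp1_idr.
  + move=> f; apply: (@kappa_heq_mono _ _ _ _ _ _ (amor f) (amor f)).
      exact: heq_refl.
    apply: heq_trans; first 
      exact: eq_heq (kappa_ker_cell_map (fmap (beta_dn C) (amor f))).
    apply: heq_trans; last by apply: heq_sym; exact: eq_heq (cmp_idr _).
    apply: heq_trans; last exact: eq_heq (cmp_idl _).
    apply: heq_cmp; first exact: kappa_to0.
    by apply: heq_kappa; exact: ker_map_dn.
- apply: coalg_cell_heq.
  + by rewrite comp1_assoc -eta_nat1 -comp1_assoc ker_unit comp1_idl.
  + by rewrite comp1_assoc mu_eta comp1_idr.
  + move=> f; apply: (@kappa_heq_mono _ _ _ _ _ _ (amor f) (amor f)).
      exact: heq_refl.
    apply: heq_trans; first 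
      exact: eq_heq (kappa_ker_cell_map (to_idm f)).
    apply: heq_cmp; first exact: heq_refl.
    by apply: kappa_heq_to0; exact: ker_idm.
- apply: coalg_cell_heq.
  + by rewrite tf1_comp comp1_assoc.
  + by rewrite !comp1_assoc mu_mu.
  + move=> Q.
    apply: heq_trans; first by apply: vcomp_along_ntc; exact: heq_refl.
    apply: heq_trans; last first.
      by apply: heq_sym; apply: vcomp_along_ntc; exact: heq_refl.
    exact: eq_heq (ker_cell_assoc (amor Q)).
Defined.

Lemma ker_lax_algebra_match : kernels_match Kr ker_lax_algebra.
Proof.
split=> [a b f|a b f|f g S]; [reflexivity| |exact: heq_refl].
apply: heq_trans; first by apply: ker_map_to0.
exact: eq_heq (cmp_idl _).
Qed.
End KernelsToLax.

(** * Cokernels from a colax algebra *)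

Section ColaxToCokernels.
Variables (C : PointedCategory)
  (A : ColaxAlgebra (T1 dist_lambda) (pointed_coalgebra C)).

Let al := colax_fun A.

Lemma colax_unit : fun_comp al (beta_up C) = fun_id C.
Proof. exact: (f_equal (@cm1 _ _ _ _ _ _) (colax_map_eta A)). Qed.

Lemma colax_from0 (a : C) : al (Arrow (from0 a)) = a.
Proof. exact: (f_equal (fun F : Functor C C => F a) colax_unit). Qed.

Lemma colax_fmap_up (a b : C) (f : Hom a b) :
  heq (fmap al (fmap (beta_up C) f)) f.
Proof. exact: (Functor_eq_fmap f colax_unit). Qed.

(** The V-coalgebra condition on [α] identifies the morphism
    [α(id_a, f) : α(id_a) -> α f] with [0 -> α f]; compare domains. *)
Lemma colax_idm (b : C) : al (Arrow (idm b)) = zero.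
Proof.
exact: (f_equal (fun F : Functor (ArrowCat C) (ArrowCat C) =>
  asrc (F (Arrow (idm b)))) (cm1_up (colax_map A))).
Qed.

Definition colax_proj (f : arrow C) : Hom (atgt f) (al f) :=
  cast_hom (colax_from0 (atgt f)) eq_refl (at_square al (square_from0 (amor f))).

Lemma heq_colax_proj (f : arrow C) :
  heq (colax_proj f) (at_square al (square_from0 (amor f))).
Proof. exact: heq_cast. Qed.

Lemma colax_proj_zero (f : arrow C) :
  colax_proj f ⋅ amor f = zeromor (asrc f) (al f).
Proof.
apply: heq_eq.
apply: heq_trans.
  apply: heq_cmp; first exact: heq_colax_proj.
  by apply: heq_sym; exact: colax_fmap_up.
rewrite -fmap_cmp.
have -> : @cmp (ArrowCat C) _ _ _ (square_from0 (amor f))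
    (fmap (beta_up C) (amor f)) =
  @cmp (ArrowCat C) _ _ _ (of_idm f) (square_from0 (idm (asrc f))).
  apply: square_eq => /=; last by rewrite cmp_idl cmp_idr.
  exact: from0_eq.
rewrite fmap_cmp cmp_through0; first exact: colax_idm.
by apply: heq_zeromor => //; exact: colax_from0.
Qed.

Definition colax_desc (f : arrow C) (x : C) (h : Hom (atgt f) x)
  (e : h ⋅ amor f = zeromor (asrc f) x) : Hom (al f) x :=
  cast_hom eq_refl (colax_from0 x)
    (at_square al (@Square C f (Arrow (from0 x)) (to0 (asrc f)) h (eq_sym e))).

Lemma colax_desc_proj (f : arrow C) (x : C) (h : Hom (atgt f) x)
  (e : h ⋅ amor f = zeromor (asrc f) x) : colax_desc e ⋅ colax_proj f = h.
Proof.
apply: heq_eq.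
apply: heq_trans; first by apply: heq_cmp; [exact: heq_cast|exact: heq_colax_proj].
rewrite /at_square -fmap_cmp.
apply: heq_trans; last exact: colax_fmap_up.
rewrite [X in fmap al X](_ : _ = fmap (beta_up C) h); last exact: heq_refl.
apply: square_eq => /=; last by rewrite cmp_idr.
exact: from0_eq.
Qed.

Lemma colax_desc_cmp (f : arrow C) (x y : C) (h : Hom (atgt f) x)
  (u : Hom x y) (e : h ⋅ amor f = zeromor (asrc f) x)
  (e' : (u ⋅ h) ⋅ amor f = zeromor (asrc f) y) :
  colax_desc e' = u ⋅ colax_desc e.
Proof.
apply: heq_eq.
apply: heq_trans; first exact: heq_cast.
apply: heq_trans; last first.
  by apply: heq_cmp; [exact: colax_fmap_up|apply: heq_sym; exact: heq_cast].
rewrite /at_square -fmap_cmp; apply: eq_heq; congr fmap.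
by apply: square_eq => //=; rewrite cmp_idl.
Qed.

Lemma colax_cell_unit (a b : C) (f : Hom a b) :
  heq (ntc (cm2 (colax_cell A))
         (@Arrow (ArrowCat C) _ _ (fmap (beta_up C) f)))
      (idm (al (Arrow f))).
Proof.
exact: (NatTrans_heqP (CoalgCell_heqP (colax_cell_tfeta A)) (Arrow f)).
Qed.

Lemma colax_cell_of_idm (f : arrow C) :
  heq (ntc (cm2 (colax_cell A)) (@Arrow (ArrowCat C) _ _ (of_idm f)))
      (idm (al f)).
Proof.
exact: (NatTrans_heqP (CoalgCell_heqP (colax_cell_eta A)) f).
Qed.

Definition proj_cube (f g : arrow C) (S : square f g) :
  @square (ArrowCat C) (@Arrow (ArrowCat C) _ _ (fmap (beta_up C) (sq1 S)))
    (@Arrow (ArrowCat C) f g S).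
Proof.
apply: (@Square (ArrowCat C)
    (@Arrow (ArrowCat C) _ _ (fmap (beta_up C) (sq1 S)))
    (@Arrow (ArrowCat C) f g S)
    (square_from0 (amor f)) (square_from0 (amor g))).
apply: square_eq => /=; last by rewrite cmp_idl cmp_idr.
exact: from0_eq.
Defined.

(** Dual to [lax_cellE]: naturality at [proj_cube S], whose domain
    [(id_0, h_1)] is one where the unit axiom applies. *)
Lemma colax_cellE (f g : arrow C) (S : square f g) :
  heq (ntc (cm2 (colax_cell A)) (@Arrow (ArrowCat C) f g S))
      (at_square al (fmap (arrow_fun al) (proj_cube S))).
Proof.
have h : fmap (fun_comp al (arrow_fun al)) (proj_cube S) ⋅ _ =
    _ ⋅ fmap (fun_comp al (arrow_fun (tgt_fun C))) (proj_cube S) :=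
  nt_nat (cm2 (colax_cell A)) (proj_cube S).
have hid : fmap (fun_comp al (arrow_fun (tgt_fun C))) (proj_cube S) =
    idm (al (Arrow (sq1 S))).
  by rewrite -fmap_id /=; congr fmap; exact: square_eq.
move: h; rewrite hid cmp_idr => <-.
apply: heq_trans; last exact: eq_heq (cmp_idr _).
apply: heq_cmp; first exact: heq_refl.
apply: heq_trans; first exact: colax_cell_unit.
apply: heq_idm; symmetry.
exact: (heq_tgt (colax_cell_unit (sq1 S))).
Qed.

(** Dual to [lax_lift_kappa], with [(id_a, f) : id_a -> f] as test square. *)
Lemma colax_desc_proj_idm (f : arrow C) :
  colax_desc (colax_proj_zero f) = idm (al f).
Proof.
apply: heq_eq; apply: heq_trans; first exact: heq_cast.
apply: heq_trans; last exact: colax_cell_of_idm.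
apply: heq_trans; last by apply: heq_sym; exact: colax_cellE.
apply: heq_fmap; apply: heq_square => /=.
- apply: arrow_eq; apply: heq_sym; exact: colax_fmap_up.
- apply: arrow_eq; apply: heq_from0 => //; exact: colax_idm.
- apply: heq_to0 => //; last exact: colax_idm.
  by symmetry; exact: colax_from0.
- exact: heq_colax_proj.
Qed.

Lemma colax_desc_unique (f : arrow C) (x : C) (h : Hom (atgt f) x)
  (e : h ⋅ amor f = zeromor (asrc f) x) (u : Hom (al f) x) :
  u ⋅ colax_proj f = h -> u = colax_desc e.
Proof.
move=> eu; subst h.
by rewrite (colax_desc_cmp (colax_proj_zero f)) colax_desc_proj_idm cmp_idr.
Qed.

Definition colax_cokernels : ChosenCokernels C.
Proof.
refine (@Build_ChosenCokernels C (fun a b f => al (Arrow f))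
  (fun a b f => colax_proj (Arrow f)) (fun a b f => colax_proj_zero (Arrow f))
  (fun a b f x h e => @colax_desc (Arrow f) x h e)
  (fun a b f x h e => @colax_desc_proj (Arrow f) x h e)
  (fun a b f x h e u => @colax_desc_unique (Arrow f) x h e u) _ _).
- move=> a; apply: heq_trans; first exact: (heq_colax_proj (Arrow (from0 a))).
  apply: heq_trans; last exact: (colax_fmap_up (idm a)).
  by apply: eq_heq; congr fmap; apply: square_eq => //; exact: from0_eq.
- move=> a; apply: heq_to0 => //; exact: colax_idm.
Defined.

Lemma colax_cokernels_match : cokernels_match colax_cokernels A.
Proof.
split=> // [a b f|f g S]; first by apply: heq_sym; exact: (heq_colax_proj (Arrow f)).
apply: eq_heq.
apply: (@coker_desc_unique C colax_cokernels _ _ _ _ _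
          (coker_map_zero colax_cokernels (transpose S))
          (at_square al (transpose S))).
apply: heq_eq => /=.
apply: heq_trans; first 
  by apply: heq_cmp; [exact: heq_refl|exact: (heq_colax_proj (Arrow (sq0 S)))].
apply: heq_trans; last first.
  apply: heq_cmp; last exact: colax_fmap_up.
  by apply: heq_sym; exact: (heq_colax_proj (Arrow (sq1 S))).
rewrite /at_square -!fmap_cmp; apply: eq_heq; congr fmap.
apply: square_eq => /=; last by rewrite cmp_idl cmp_idr.
exact: from0_eq.
Qed.

End ColaxToCokernels.

Lemma ChosenCokernels_eq (C : PointedCategory) (K K' : ChosenCokernels C) :
  (forall (a b : C) (f : Hom a b), heq (proj K f) (proj K' f)) -> K = K'.
Proof.
destruct K as [k p z d dp u n1 n2]; destruct K' as [k' p' z' d' dp' u' n1' n2'] => /= h.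
have e : k = k'.
  by do 3 (apply: functional_extensionality_dep => ?); exact: heq_tgt (h _ _ _).
subst k'.
have e : p = p'.
  by do 3 (apply: functional_extensionality_dep => ?); exact: heq_eq (h _ _ _).
subst p'; rewrite (proof_irrelevance _ z' z).
have e : d = d'.
  by do 6 (apply: functional_extensionality_dep => ?); exact: u'.
subst d'; f_equal; exact: proof_irrelevance.
Qed.

Lemma cokernels_match_unique (C : PointedCategory)
  (A : ColaxAlgebra (T1 dist_lambda) (pointed_coalgebra C))
  (K K' : ChosenCokernels C) :
  cokernels_match K A -> cokernels_match K' A -> K = K'.
Proof.
move=> m m'; apply: ChosenCokernels_eq => a b f.
exact: heq_trans (heq_sym (match_proj m f)) (match_proj m' f).
Qed.

Lemma ColaxAlgebra_eq (C : PointedCategory)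
  (A A' : ColaxAlgebra (T1 dist_lambda) (pointed_coalgebra C)) :
  colax_fun A = colax_fun A' -> A = A'.
Proof.
have := @colax_cellE C A; have := @colax_cellE C A'.
destruct A as [m c e1 e2 e3 e4]; destruct A' as [m' c' e1' e2' e3' e4'].
rewrite /colax_fun /= => h' h /(@CoalgMap_eq _ _ _ _ _ _ m m') em; subst m'.
have ec : c = c'.
  apply: CoalgCell_eq; apply: NatTrans_eq => [[f g S]]; apply: heq_eq.
  exact: heq_trans (h _ _ _) (heq_sym (h' _ _ _)).
by subst c'; f_equal; exact: proof_irrelevance.
Qed.

(** The match speaks of transposed squares only, and every square is one. *)
Lemma colax_algebra_match_unique (C : PointedCategory) (K : ChosenCokernels C)
  (A A' : ColaxAlgebra (T1 dist_lambda) (pointed_coalgebra C)) :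
  cokernels_match K A -> cokernels_match K A' -> A = A'.
Proof.
move=> m m'; apply: ColaxAlgebra_eq; apply: Functor_eq => f g S.
have := heq_trans (match_coker_map m (transpose S))
  (heq_sym (match_coker_map m' (transpose S))).
by rewrite transposeK.
Qed.

(** * Colax algebras from cokernels *)

Section CokernelsToColax.
Variables (C : PointedCategory) (Ck : ChosenCokernels C).

Lemma proj_epi (a b : C) (f : Hom a b) (x : C) (u v : Hom (coker Ck f) x) :
  u ⋅ proj Ck f = v ⋅ proj Ck f -> u = v.
Proof.
move=> e.
have hv : (v ⋅ proj Ck f) ⋅ f = zeromor a x.
  by rewrite cmp_assoc proj_zero zeromor_cmp_l.
by rewrite (coker_desc_unique hv e); symmetry; exact: coker_desc_unique.
Qed.

Lemma heq_proj (a b a' b' : C) (f : Hom a b) (f' : Hom a' b') :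
  heq f f' -> heq (proj Ck f) (proj Ck f').
Proof. by move=> h; destruct h; exact: heq_refl. Qed.

Lemma proj_heq_epi (a b a' b' x x' : C) (f : Hom a b) (f' : Hom a' b')
  (u : Hom (coker Ck f) x) (u' : Hom (coker Ck f') x') : heq f f' ->
  heq (u ⋅ proj Ck f) (u' ⋅ proj Ck f') -> heq u u'.
Proof.
move=> h hu; destruct h; have ex := heq_tgt hu; subst x'.
by apply: eq_heq; apply: proj_epi; exact: heq_eq.
Qed.

Lemma coker_map_proj (a b c d : C) (f : Hom a b) (g : Hom c d)
  (S : square (Arrow f) (Arrow g)) :
  coker_map Ck S ⋅ proj Ck f = proj Ck g ⋅ sq1 S.
Proof. exact: desc_proj. Qed.

Definition coker_fun : Functor (ArrowCat C) C.
Proof.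
refine (@Build_Functor (ArrowCat C) C (fun f => coker Ck (amor f))
  (fun f g S => coker_map Ck S) _ _).
- by move=> f; apply: proj_epi; rewrite coker_map_proj cmp_idl cmp_idr.
- move=> f g h T S; apply: proj_epi.
  by rewrite coker_map_proj cmp_assoc coker_map_proj -!cmp_assoc coker_map_proj.
Defined.

Lemma coker_idm (a : C) : coker Ck (idm a) = zero.
Proof. exact: heq_tgt (proj_idm Ck a). Qed.

Lemma proj_heq_from0 (a b : C) (f : Hom a b) :
  a = zero -> heq (proj Ck f) (idm b).
Proof.
by move=> eb; subst a; rewrite (from0_unique f); exact: proj_from0.
Qed.

(** Dual to [ker_map_to0]: the cokernel projection out of a morphism from zero is
    an identity. *)
Lemma coker_map_from0 (a b c d : C) (p : Hom a b) (f : Hom c d)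
  (S : square (Arrow p) (Arrow f)) :
  a = zero -> heq (coker_map Ck S) (proj Ck f ⋅ sq1 S).
Proof.
move=> ea; apply: heq_trans; last exact: eq_heq (coker_map_proj S).
apply: heq_trans; first by apply: heq_sym; apply: eq_heq; exact: cmp_idr.
have hp : heq (proj Ck p) (idm b) by exact: proj_heq_from0.
apply: heq_cmp; first exact: heq_refl.
apply: heq_trans; last by apply: heq_sym; exact: hp.
by apply: heq_idm; exact: heq_tgt hp.
Qed.

Lemma coker_map_up (a b : C) (f : Hom a b) :
  heq (coker_map Ck (fmap (beta_up C) f)) f.
Proof.
apply: heq_trans; first by apply: coker_map_from0.
apply: heq_trans; last exact: eq_heq (cmp_idl _).
by apply: heq_cmp; [exact: proj_from0|exact: heq_refl].
Qed.

Definition coker_coalg_map :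
  cell1 (T1 dist_lambda (pointed_coalgebra C)) (pointed_coalgebra C).
Proof.
refine (@Build_CoalgMap _ _ _ dist_lambda (T1_ob (pointed_coalgebra C))
  (pointed_coalgebra C) coker_fun _ _);
  apply: Functor_eq => f g S; apply: heq_square => /=.
- by apply: arrow_eq; apply: heq_from0 => //; exact: coker_idm.
- by apply: arrow_eq; apply: heq_from0 => //; exact: coker_idm.
- by apply: heq_from0 => //; exact: coker_idm.
- exact: heq_refl.
- by apply: arrow_eq; apply: heq_to0 => //; exact: coker_idm.
- by apply: arrow_eq; apply: heq_to0 => //; exact: coker_idm.
- by apply: eq_heq; congr coker_map; exact: square_eq.
- by apply: heq_to0 => //; exact: coker_idm.
Defined.

Lemma coker_cell_zero (f g : arrow C) (S : square f g) :
  (proj Ck (coker_map Ck S) ⋅ proj Ck (amor g)) ⋅ sq1 S =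
  zeromor (atgt f) (coker Ck (coker_map Ck S)).
Proof.
by rewrite cmp_assoc -coker_map_proj -cmp_assoc proj_zero zeromor_cmp_r.
Qed.

Definition coker_cell_map (f g : arrow C) (S : square f g) :
  Hom (coker Ck (sq1 S)) (coker Ck (coker_map Ck S)) :=
  coker_desc Ck (coker_cell_zero S).

Lemma coker_cell_map_proj (f g : arrow C) (S : square f g) :
  coker_cell_map S ⋅ proj Ck (sq1 S) =
  proj Ck (coker_map Ck S) ⋅ proj Ck (amor g).
Proof. exact: desc_proj. Qed.

Definition coker_cell_nt : NatTrans
  (fun_comp coker_fun (arrow_fun (tgt_fun C)))
  (fun_comp coker_fun (arrow_fun coker_fun)).
Proof.
exists (fun S : arrow (ArrowCat C) =>
  @coker_cell_map (asrc S) (atgt S) (amor S)) => S S' Q.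
apply: proj_epi.
rewrite [LHS]cmp_assoc (coker_cell_map_proj (amor S)) -[LHS]cmp_assoc.
rewrite (@coker_map_proj _ _ _ _ (coker_map Ck (amor S))) /=.
rewrite [LHS]cmp_assoc (@coker_map_proj _ _ _ _ (amor (atgt S))).
rewrite [RHS]cmp_assoc (@coker_map_proj _ _ _ _ (sq1 (amor S))) /=.
by rewrite -[RHS]cmp_assoc (coker_cell_map_proj (amor S')) cmp_assoc.
Defined.

Definition coker_cell : cell2
  (coker_coalg_map ∘ mu (T1 dist_lambda) (pointed_coalgebra C))
  (coker_coalg_map ∘ tf1 (T1 dist_lambda) coker_coalg_map).
Proof.
exact: (@pointed_cell C (T1 dist_lambda (T1 dist_lambda (pointed_coalgebra C)))
  (coker_coalg_map ∘ mu (T1 dist_lambda) (pointed_coalgebra C))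
  (coker_coalg_map ∘ tf1 (T1 dist_lambda) coker_coalg_map) coker_cell_nt).
Defined.

(** Dual to [ker_cell_assoc]: precomposed with [π], both sides become the same
    composite of three cokernel projections. *)
Lemma coker_cell_assoc (S S' : arrow (ArrowCat C)) (q : square S S') :
  coker_cell_map (fmap (arrow_fun coker_fun) q) ⋅ coker_cell_map (sq1 q) =
  coker_map Ck (ntc (arrow_nt coker_cell_nt) (@Arrow (ArrowCat (ArrowCat C)) S S' q))
   ⋅ coker_cell_map (fmap (arrow_fun (tgt_fun C)) q).
Proof.
apply: proj_epi; rewrite [LHS]cmp_assoc coker_cell_map_proj.
rewrite -[LHS]cmp_assoc (coker_cell_map_proj (fmap (arrow_fun coker_fun) q)).
rewrite [RHS]cmp_assoc (coker_cell_map_proj (fmap (arrow_fun (tgt_fun C)) q)).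
rewrite -[RHS]cmp_assoc.
rewrite (@coker_map_proj _ _ _ _ (coker_map Ck (fmap (arrow_fun (tgt_fun C)) q))).
by rewrite [RHS]cmp_assoc (coker_cell_map_proj (amor S')) cmp_assoc.
Qed.

Lemma coker_unit :
  coker_coalg_map ∘ eta (T1 dist_lambda) (pointed_coalgebra C) =
  id1 (pointed_coalgebra C).
Proof.
apply: CoalgMap_eq; apply: Functor_eq => a b f; exact: coker_map_up.
Qed.

Definition coker_colax_algebra :
  ColaxAlgebra (T1 dist_lambda) (pointed_coalgebra C).
Proof.
refine (@Build_ColaxAlgebra _ _ _ coker_coalg_map coker_cell coker_unit _ _ _).
- apply: coalg_cell_heq.
  + by rewrite comp1_assoc mu_tfeta comp1_idr.
  + by rewrite comp1_assoc -tf1_comp coker_unit tf1_id comp1_idr.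
  + move=> f; apply: (@proj_heq_epi _ _ _ _ _ _ (amor f) (amor f)).
      exact: heq_refl.
    apply: heq_trans; first
      exact: eq_heq (coker_cell_map_proj (fmap (beta_up C) (amor f))).
    apply: heq_trans; last by apply: heq_sym; exact: eq_heq (cmp_idl _).
    apply: heq_trans; last exact: eq_heq (cmp_idr _).
    apply: heq_cmp; last exact: proj_from0.
    by apply: heq_proj; exact: coker_map_up.
- apply: coalg_cell_heq.
  + by rewrite comp1_assoc mu_eta comp1_idr.
  + by rewrite comp1_assoc -eta_nat1 -comp1_assoc coker_unit comp1_idl.
  + move=> f; apply: (@proj_heq_epi _ _ _ _ _ _ (amor f) (amor f)).
      exact: heq_refl.
    apply: heq_trans; first exact: eq_heq (coker_cell_map_proj (of_idm f)).
    apply: heq_cmp; last exact: heq_refl.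
    by apply: proj_heq_from0; exact: coker_idm.
- apply: coalg_cell_heq.
  + by rewrite !comp1_assoc mu_mu.
  + by rewrite tf1_comp comp1_assoc.
  + move=> Q.
    apply: heq_trans; first by apply: vcomp_along_ntc; exact: heq_refl.
    apply: heq_trans; last first.
      by apply: heq_sym; apply: vcomp_along_ntc; exact: heq_refl.
    exact: eq_heq (coker_cell_assoc (amor Q)).
Defined.

Lemma coker_colax_algebra_match : cokernels_match Ck coker_colax_algebra.
Proof.
split=> [a b f|a b f|f g S]; [reflexivity| |exact: heq_refl].
apply: heq_trans; first by apply: coker_map_from0.
exact: eq_heq (cmp_idr _).
Qed.
End CokernelsToColax.

(** * The mixed lax rewriting rule *)

(** The first leg of the map from [id_0 -> g] to [S] along which naturality of
    [ψ] determines [ψ_S]. *)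
Definition square_of_zero (C : PointedCategory) (f : arrow C) :
  square (Arrow (idm zero)) f :=
  @Square C (Arrow (idm zero)) f (from0 (asrc f)) (from0 (atgt f))
    (from0_eq _ _).

Section MixedRule.
Variables (C : PointedCategory) (Ck : ChosenCokernels C) (Kr : ChosenKernels C).

Lemma mixed_lift_zero (f g : arrow C) (S : square f g) :
  coker_map Ck (transpose S) ⋅ (proj Ck (sq0 S) ⋅ kappa Kr (amor g)) =
  zeromor (ker Kr (amor g)) (coker Ck (sq1 S)).
Proof.
rewrite -cmp_assoc (coker_map_proj Ck (transpose S)) cmp_assoc /=.
by rewrite kappa_zero zeromor_cmp_l.
Qed.

(** Lifting comes before descending: that the lift kills [ker_map S] is then
    checked inside a kernel. *)
Definition mixed_lift (f g : arrow C) (S : square f g) :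
  Hom (ker Kr (amor g)) (ker Kr (coker_map Ck (transpose S))) :=
  ker_lift Kr (mixed_lift_zero S).

Lemma mixed_desc_zero (f g : arrow C) (S : square f g) :
  mixed_lift S ⋅ ker_map Kr S =
  zeromor (ker Kr (amor f)) (ker Kr (coker_map Ck (transpose S))).
Proof.
apply: kappa_mono.
rewrite -cmp_assoc kappa_lift cmp_assoc (@kappa_ker_map _ Kr _ _ _ _ (amor f)).
by rewrite -cmp_assoc proj_zero zeromor_cmp_l zeromor_cmp_r.
Qed.

Definition mixed_map (f g : arrow C) (S : square f g) :
  Hom (coker Ck (ker_map Kr S)) (ker Kr (coker_map Ck (transpose S))) :=
  coker_desc Ck (mixed_desc_zero S).

Lemma mixed_mapE (f g : arrow C) (S : square f g) :
  kappa Kr (coker_map Ck (transpose S)) ⋅ mixed_map S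
    ⋅ proj Ck (ker_map Kr S) = proj Ck (sq0 S) ⋅ kappa Kr (amor g).
Proof. by rewrite cmp_assoc desc_proj kappa_lift. Qed.

Lemma kappa_proj_inj (a b c d : C) (p : Hom a b) (q : Hom c d)
  (u v : Hom (coker Ck p) (ker Kr q)) :
  kappa Kr q ⋅ u ⋅ proj Ck p = kappa Kr q ⋅ v ⋅ proj Ck p -> u = v.
Proof. by move=> /proj_epi /kappa_mono. Qed.

Lemma mixed_map_unique (f g : arrow C) (S : square f g)
  (v : Hom (coker Ck (ker_map Kr S)) (ker Kr (coker_map Ck (transpose S)))) :
  kappa Kr (coker_map Ck (transpose S)) ⋅ v ⋅ proj Ck (ker_map Kr S) =
    proj Ck (sq0 S) ⋅ kappa Kr (amor g) ->
  mixed_map S = v.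
Proof. by move=> e; apply: kappa_proj_inj; rewrite mixed_mapE e. Qed.

Let A1 := coker_colax_algebra Ck.
Let A2 := ker_lax_algebra Kr.

Definition mixed_nt : NatTrans
  (fun_comp (coker_fun Ck) (arrow_fun (ker_fun Kr)))
  (fun_comp (ker_fun Kr)
     (fun_comp (arrow_fun (coker_fun Ck)) (transpose_fun C))).
Proof.
exists (fun S : arrow (ArrowCat C) => @mixed_map (asrc S) (atgt S) (amor S))
  => S S' Q.
apply: kappa_proj_inj.
rewrite -[X in X ⋅ _ = _]cmp_assoc -[X in _ = X ⋅ _]cmp_assoc.
rewrite (@kappa_ker_map _ Kr _ _ _ _ (coker_map Ck (transpose (amor S)))) /=.
rewrite [X in X ⋅ _ = _]cmp_assoc [LHS]cmp_assoc mixed_mapE.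
rewrite -[LHS]cmp_assoc (@coker_map_proj _ Ck _ _ _ _ (sq0 (amor S)) (sq0 (amor S'))) /=.
rewrite [RHS]cmp_assoc (@coker_map_proj _ Ck _ _ _ _ (ker_map Kr (amor S))) /=.
rewrite -[RHS]cmp_assoc (mixed_mapE (amor S')) [LHS]cmp_assoc [RHS]cmp_assoc.
by rewrite (@kappa_ker_map _ Kr _ _ _ _ (amor (atgt S))).
Defined.

Definition mixed_cell : MixedCell A1 A2.
Proof.
exact: (@pointed_cell C (T1 dist_lambda (T2 dist_lambda (pointed_coalgebra C)))
  (colax_map A1 ∘ tf1 (T1 dist_lambda) (lax_map A2))
  (lax_map A2 ∘ tf1 (T2 dist_lambda) (colax_map A1)
     ∘ mlam (coalg_dist dist_lambda) (pointed_coalgebra C)) mixed_nt).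
Defined.

(** The defining equation of [ψ_S] for a representative [u] whose codomain is
    written with another proof that the transposed square commutes. *)
Lemma heq_mixed_mapE (f g : arrow C) (S : square f g)
  (T : square (Arrow (sq0 S)) (Arrow (sq1 S)))
  (u : Hom (coker Ck (ker_map Kr S)) (ker Kr (coker_map Ck T))) :
  transpose S = T -> heq (mixed_map S) u ->
  kappa Kr (coker_map Ck T) ⋅ u ⋅ proj Ck (ker_map Kr S) =
  proj Ck (sq0 S) ⋅ kappa Kr (amor g).
Proof. by move=> eT; subst T => hu; rewrite -(heq_eq hu) mixed_mapE. Qed.

Lemma coker_map_of_zero (f : arrow C) (S : square (Arrow (idm zero)) f) :
  heq (coker_map Ck (transpose S)) (amor f).
Proof.
apply: heq_trans; first by apply: coker_map_from0.
apply: heq_trans; last exact: eq_heq (cmp_idl _).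
apply: heq_cmp; last exact: heq_refl.
exact: proj_heq_from0.
Qed.

(** This gives [mixed_rule_c]: the cokernel on the left of [ψ_S] is that of a
    morphism from zero and [h_0] starts at zero, so [π] and [π_{h_0}] are
    identities and the defining equation reads [κ_f ψ_S = κ_f]. *)
Lemma mixed_map_of_zero (f : arrow C) (S : square (Arrow (idm zero)) f) :
  heq (mixed_map S) (idm (ker Kr (amor f))).
Proof.
have hp : heq (proj Ck (ker_map Kr S)) (idm (ker Kr (amor f))).
  by apply: proj_heq_from0; exact: ker_idm.
have h0 : heq (proj Ck (sq0 S)) (idm (asrc f)) by exact: proj_heq_from0.
have hq := coker_map_of_zero S.
apply: heq_trans; first by apply: heq_sym; exact: eq_heq (cmp_idr _).
apply: heq_trans.
  apply: heq_cmp; first exact: heq_refl.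
  apply: heq_trans; last by apply: heq_sym; exact: hp.
  by apply: heq_idm; exact: heq_tgt hp.
apply: kappa_heq_mono; first exact: hq.
rewrite -cmp_assoc mixed_mapE.
apply: heq_trans; last by apply: heq_sym; exact: eq_heq (cmp_idr _).
apply: heq_trans; last exact: eq_heq (cmp_idl _).
apply: heq_cmp; [exact: h0|exact: heq_refl].
Qed.

(** This gives [mixed_rule_d], dually: [κ] and [κ_g] are identities, and the
    defining equation reads [ψ_S π = π_{h_0}]. *)
Lemma mixed_map_to_zero (a b : C) (S : square (Arrow (to0 a)) (Arrow (to0 b))) :
  heq (mixed_map S) (idm (coker Ck (sq0 S))).
Proof.
have hq : heq (kappa Kr (coker_map Ck (transpose S))) (idm (coker Ck (sq0 S))).
  apply: kappa_heq_to0; rewrite /= (to0_unique (sq1 S)) -(to0_unique (idm zero)).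
  exact: coker_idm.
have h0 : heq (kappa Kr (to0 b)) (idm b) by exact: kappa_to0.
have hp : heq (ker_map Kr S) (sq0 S).
  apply: heq_trans; first by apply: ker_map_to0.
  apply: heq_trans; last exact: eq_heq (cmp_idr _).
  apply: heq_cmp; first exact: heq_refl.
  exact: kappa_to0.
apply: heq_trans; first by apply: heq_sym; exact: eq_heq (cmp_idl _).
apply: heq_trans.
  apply: heq_cmp; last exact: heq_refl.
  apply: heq_trans; last by apply: heq_sym; exact: hq.
  by apply: heq_idm; exact: heq_src hq.
apply: proj_heq_epi; first exact: hp.
rewrite mixed_mapE.
apply: heq_trans; last by apply: heq_sym; exact: eq_heq (cmp_idl _).
apply: heq_trans; last exact: eq_heq (cmp_idr _).
apply: heq_cmp; [exact: heq_refl|exact: h0].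
Qed.

(** This gives [mixed_rule_a]. Between [κ] and [π], the defining equations of
    [φ] and of the map induced on kernels expose two instances of the equation
    of [ψ] on the left, and the one of the map induced on cokernels exposes a
    single instance on the right; both sides end as [π κ κ]. *)
Lemma mixed_map_ker_cell (S S' : arrow (ArrowCat C)) (q : square S S')
  (u : Hom (coker Ck (ker_map Kr (fmap (arrow_fun (ker_fun Kr)) q)))
    (ker Kr (coker_map Ck (fmap (arrow_fun (ker_fun Kr)) (transpose q))))) :
  heq (mixed_map (fmap (arrow_fun (ker_fun Kr)) q)) u ->
  heq (ker_cell_map Kr (fmap (arrow_fun (coker_fun Ck))
           (fmap (transpose_fun C) (transpose q)))
         ⋅ (ker_map Kr (ntc (arrow_nt mixed_nt)
              (@Arrow (ArrowCat (ArrowCat C)) _ _ (transpose q))) ⋅ u))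
      (mixed_map (fmap (arrow_fun (src_fun C)) q)
         ⋅ coker_map Ck (ntc (arrow_nt (ker_cell_nt Kr))
              (@Arrow (ArrowCat (ArrowCat C)) _ _ q))).
Proof.
move=> hu.
have eu := heq_mixed_mapE (transpose_fmap (ker_fun Kr) q) hu.
apply: (@kappa_heq_mono _ Kr _ _ _ _ _ _
  (coker_map Ck (sq0 (fmap (transpose_fun C) (transpose q))))
  (coker_map Ck (transpose (fmap (arrow_fun (src_fun C)) q)))).
  by apply: eq_heq; congr coker_map; exact: square_eq.
apply: eq_heq; apply: proj_epi.
have e1 := kappa_ker_cell_map Kr (fmap (arrow_fun (coker_fun Ck))
           (fmap (transpose_fun C) (transpose q))).
have e2 := kappa_ker_map Kr (ntc (arrow_nt mixed_nt)
              (@Arrow (ArrowCat (ArrowCat C)) _ _ (transpose q))).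
have e3 := mixed_mapE (sq0 q).
have e4 := mixed_mapE (fmap (arrow_fun (src_fun C)) q).
have e5 := coker_map_proj Ck (ntc (arrow_nt (ker_cell_nt Kr))
              (@Arrow (ArrowCat (ArrowCat C)) _ _ q)).
have e6 := kappa_ker_cell_map Kr (amor S').
rewrite !cmp_assoc e5.
rewrite (cmp_reassoc3 e4) !cmp_assoc e6.
rewrite cmp_assoc in eu.
rewrite (cmp_reassoc e1) !cmp_assoc (cmp_reassoc e2) !cmp_assoc eu.
rewrite (cmp_reassoc3 e3).
by rewrite !cmp_assoc.
Qed.

(** This gives [mixed_rule_b], by the dual computation: both sides end as
    [π π κ]. *)
Lemma mixed_map_coker_cell (S S' : arrow (ArrowCat C)) (q : square S S')
  (r := transpose (fmap (transpose_fun C) q))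
  (u : Hom (coker Ck (ker_map Kr (sq1 q)))
         (ker Kr (coker_map Ck (fmap (arrow_fun (tgt_fun C)) r)))) :
  heq (mixed_map (sq1 q)) u ->
  heq (mixed_map (fmap (arrow_fun (coker_fun Ck)) (fmap (transpose_fun C) q))
         ⋅ (coker_map Ck (ntc (arrow_nt mixed_nt)
              (@Arrow (ArrowCat (ArrowCat C)) _ _ q))
            ⋅ coker_cell_map Ck (fmap (arrow_fun (ker_fun Kr)) q)))
      (ker_map Kr (ntc (arrow_nt (coker_cell_nt Ck))
           (@Arrow (ArrowCat (ArrowCat C)) _ _ r))
         ⋅ u).
Proof.
move=> hu.
have er : transpose (sq1 q) = fmap (arrow_fun (tgt_fun C)) r by exact: square_eq.
have eu := heq_mixed_mapE er hu.
apply: (@kappa_heq_mono _ Kr _ _ _ _ _ _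
  (coker_map Ck (transpose (fmap (arrow_fun (coker_fun Ck))
      (fmap (transpose_fun C) q))))
  (coker_map Ck (fmap (arrow_fun (coker_fun Ck)) r))).
  by apply: eq_heq; congr coker_map; exact: square_eq.
apply: eq_heq; apply: proj_epi.
have e1 := coker_cell_map_proj Ck (fmap (arrow_fun (ker_fun Kr)) q).
have e2 := coker_map_proj Ck (ntc (arrow_nt mixed_nt)
              (@Arrow (ArrowCat (ArrowCat C)) _ _ q)).
have e3 := mixed_mapE (fmap (arrow_fun (coker_fun Ck)) (fmap (transpose_fun C) q)).
have e4 := mixed_mapE (amor S').
have e5 := kappa_ker_map Kr (ntc (arrow_nt (coker_cell_nt Ck))
           (@Arrow (ArrowCat (ArrowCat C)) _ _ r)).
have e6 := coker_cell_map_proj Ck (sq0 (fmap (transpose_fun C) q)).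
rewrite !cmp_assoc e1 (cmp_reassoc e2) !cmp_assoc (cmp_reassoc3 e3).
rewrite (cmp_reassoc e5) !cmp_assoc.
rewrite cmp_assoc in e4; rewrite e4.
rewrite cmp_assoc in eu; rewrite eu.
by rewrite (cmp_reassoc e6) !cmp_assoc.
Qed.

(** In the two associativity axioms one component must first be transported
    along a change of commutativity proof of a transposed square, so that the
    vertical composites become composites in [C]. *)
Lemma mixed_cell_rule :
  is_mixed_lax_rule (D := coalg_dist dist_lambda) mixed_cell.
Proof.
split; apply: coalg_cell_heq.
- by rewrite tf1_comp !comp1_assoc.
- rewrite !comp1_assoc mlam_mur (comp1_reassoc (mu_nat1 _ _)).
  by rewrite !comp1_assoc.
- move=> Q.
  have e := f_equal (fun T => ker Kr (coker_map Ck T))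
    (transpose_fmap (ker_fun Kr) (amor Q)).
  have hu := heq_sym (heq_cast eq_refl e
    (mixed_map (fmap (arrow_fun (ker_fun Kr)) (amor Q)))).
  apply: heq_trans.
    apply: vcomp_along_ntc; first exact: heq_refl.
    by apply: vcomp_along_ntc; [exact: heq_refl|exact: hu].
  apply: heq_trans; last first.
    by apply: heq_sym; apply: vcomp_along_ntc; exact: heq_refl.
  exact: mixed_map_ker_cell hu.
- by rewrite !comp1_assoc mu_nat1.
- rewrite !(comp1_assoc, tf1_comp) (comp1_reassoc (mlam_nat1 _ _)).
  by rewrite !comp1_assoc.
- move=> Q.
  have e : ker Kr (coker_map Ck (transpose (sq1 (amor Q)))) =
    ker Kr (coker_map Ck (fmap (arrow_fun (tgt_fun C))
      (transpose (fmap (transpose_fun C) (amor Q))))).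
    by congr (ker Kr (coker_map Ck _)); exact: square_eq.
  have hu := heq_sym (heq_cast eq_refl e (mixed_map (sq1 (amor Q)))).
  apply: heq_trans.
    apply: vcomp_along_ntc; first exact: heq_refl.
    by apply: vcomp_along_ntc; exact: heq_refl.
  apply: heq_trans; last first.
    apply: heq_sym; apply: vcomp_along_ntc; [exact: heq_refl|exact: hu].
  exact: mixed_map_coker_cell hu.
- by rewrite comp1_assoc -eta_nat1 -comp1_assoc colax_map_eta comp1_idl.
- rewrite !comp1_assoc mlam_etal -tf1_comp colax_map_eta tf1_id.
  by rewrite comp1_idr.
- move=> f; exact: mixed_map_of_zero.
- by rewrite !comp1_assoc -tf1_comp lax_map_eta tf1_id comp1_idr.
- rewrite !comp1_assoc mlam_etar -eta_nat1 -comp1_assoc lax_map_eta.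
  by rewrite comp1_idl.
- move=> f; exact: mixed_map_to_zero.
Qed.

(** Naturality along [c], from the square [0 -> g] to [S]: by [mixed_rule_c]
    the rule is an identity at [0 -> g], the source functor sends [c] to the
    projection [π] of [ψ_S], and the target functor sends it to the map of
    kernels induced by [π_{h_0}]. *)
Lemma mixed_cell_unique (psi : MixedCell A1 A2) :
  is_mixed_lax_rule (D := coalg_dist dist_lambda) psi ->
  mixed_cell = psi.
Proof.
move=> hpsi; apply: CoalgCell_eq; apply: NatTrans_eq => [[f g S]].
apply: mixed_map_unique.
pose S0 := transpose_fun C (@Arrow (ArrowCat C) _ _ (fmap (beta_up C) (amor g))).
have ec : @cmp (ArrowCat C) _ _ _ S (square_of_zero f) =
    @cmp (ArrowCat C) _ _ _ (@idm (ArrowCat C) g) (amor S0).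
  by apply: square_eq; exact: from0_eq.
pose c : square S0 (@Arrow (ArrowCat C) f g S) :=
  @Square (ArrowCat C) S0 (@Arrow (ArrowCat C) f g S) (square_of_zero f)
    (@idm (ArrowCat C) g) ec.
have hnat : fmap (fun_comp (ker_fun Kr)
     (fun_comp (arrow_fun (coker_fun Ck)) (transpose_fun C))) c ⋅ _ =
  _ ⋅ fmap (fun_comp (coker_fun Ck) (arrow_fun (ker_fun Kr))) c :=
  nt_nat (cm2 psi) c.
have h0 : heq (ntc (cm2 psi) S0) (idm (ker Kr (amor g))).
  exact: (NatTrans_heqP (CoalgCell_heqP (mixed_rule_c hpsi)) g).
apply: heq_eq.
apply: heq_trans.
  have hF : heq (proj Ck (ker_map Kr S))
      (fmap (fun_comp (coker_fun Ck) (arrow_fun (ker_fun Kr))) c).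
    apply: heq_sym; apply: heq_trans.
      by apply: coker_map_from0; exact: ker_idm.
    apply: heq_trans; last exact: eq_heq (cmp_idr _).
    apply: heq_cmp; first exact: heq_refl.
    exact: eq_heq (fmap_id (ker_fun Kr) g).
  by apply: heq_cmp; [exact: heq_refl|exact: hF].
rewrite cmp_assoc -hnat -cmp_assoc.
rewrite (@kappa_ker_map _ Kr _ _ _ _ (coker_map Ck (transpose (amor S0)))
  (coker_map Ck (transpose S))).
apply: heq_trans.
  apply: heq_cmp; last exact: h0.
  have hk : heq (kappa Kr (coker_map Ck (transpose (amor S0))))
      (kappa Kr (amor g)).
    by apply: heq_kappa; exact: coker_map_of_zero.
  apply: heq_cmp; last exact: hk.
  by apply: coker_map_from0.
apply: eq_heq.
by rewrite /= !cmp_idr.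
Qed.

Lemma canonical_mixed_rule :
  unique (@is_mixed_lax_rule _ _ _ (coalg_dist dist_lambda) _ A1 A2) mixed_cell.
Proof.
split; [exact: mixed_cell_rule|exact: mixed_cell_unique].
Qed.
End MixedRule.

Theorem proposition21 (C : PointedCategory) :
  (inhabited (ChosenCokernels C * ChosenKernels C) <->
   inhabited (ColaxAlgebra (T1 dist_lambda) (pointed_coalgebra C) *
              LaxAlgebra (T2 dist_lambda) (pointed_coalgebra C))) /\
  (forall (Ck : ChosenCokernels C) (Kr : ChosenKernels C),
     exists! A : ColaxAlgebra (T1 dist_lambda) (pointed_coalgebra C) *
                 LaxAlgebra (T2 dist_lambda) (pointed_coalgebra C),
       cokernels_match Ck (fst A) /\ kernels_match Kr (snd A)) /\
  (forall (A1 : ColaxAlgebra (T1 dist_lambda) (pointed_coalgebra C))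
          (A2 : LaxAlgebra (T2 dist_lambda) (pointed_coalgebra C)),
     exists! P : ChosenCokernels C * ChosenKernels C,
       cokernels_match (fst P) A1 /\ kernels_match (snd P) A2) /\
  (forall (Ck : ChosenCokernels C) (Kr : ChosenKernels C)
          (A1 : ColaxAlgebra (T1 dist_lambda) (pointed_coalgebra C))
          (A2 : LaxAlgebra (T2 dist_lambda) (pointed_coalgebra C)),
     cokernels_match Ck A1 -> kernels_match Kr A2 ->
     exists psi : MixedCell A1 A2,
       unique (@is_mixed_lax_rule _ _ _ (coalg_dist dist_lambda) _ A1 A2) psi /\
       forall (f g : arrow C) (S : square f g),
         exists u : Hom (coker Ck (ker_map Kr S))
                        (ker Kr (coker_map Ck (transpose S))),
           heq (mixed_component psi S) u /\
           unique (fun v => kappa Kr (coker_map Ck (transpose S)) ⋅ v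
                              ⋅ proj Ck (ker_map Kr S)
                            = proj Ck (sq0 S) ⋅ kappa Kr (amor g)) u).
Proof.
split; [|split; [|split]].
- split=> [[[Ck Kr]]|[[A1 A2]]].
  + exact: inhabits (coker_colax_algebra Ck, ker_lax_algebra Kr).
  + exact: inhabits (colax_cokernels A1, lax_kernels A2).
- move=> Ck Kr; exists (coker_colax_algebra Ck, ker_lax_algebra Kr); split.
    by split; [exact: coker_colax_algebra_match|exact: ker_lax_algebra_match].
  move=> [A1 A2] /= [m1 m2]; congr pair.
  + exact: colax_algebra_match_unique (coker_colax_algebra_match Ck) m1.
  + exact: lax_algebra_match_unique (ker_lax_algebra_match Kr) m2.
- move=> A1 A2; exists (colax_cokernels A1, lax_kernels A2); split.
    by split; [exact: colax_cokernels_match|exact: lax_kernels_match].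
  move=> [Ck Kr] /= [m1 m2]; congr pair.
  + exact: cokernels_match_unique (colax_cokernels_match A1) m1.
  + exact: kernels_match_unique (lax_kernels_match A2) m2.
- move=> Ck Kr A1 A2 m1 m2.
  (* Matching algebras are the canonical ones, where the types of [ψ_S] and of
     the induced morphism coincide. *)
  have e1 := colax_algebra_match_unique (coker_colax_algebra_match Ck) m1.
  have e2 := lax_algebra_match_unique (ker_lax_algebra_match Kr) m2.
  subst A1 A2; exists (mixed_cell Ck Kr); split.
    exact: canonical_mixed_rule.
  move=> f g S; exists (mixed_map Ck Kr S); split; first exact: heq_refl.
  by split; [exact: mixed_mapE|exact: mixed_map_unique].
Qed.
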